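(* Let $V$ be a locally linearly compact vector space over a discrete field $\mathbb K$, let $\phi\colon V\to V$ be a continuous endomorphism, and let $W$ be a closed linear subspace of $V$ which is $\phi$-invariant (i.e. $\phi W\leq W$). Then $$\mathrm{ent}(\phi)=\mathrm{ent}(\phi\restriction_W)+\mathrm{ent}(\overline\phi),$$ where $\phi\restriction_W\colon W\to W$ is the restriction of $\phi$ (with $W$ carrying the induced topology) and $\overline\phi\colon V/W\to V/W$ is the continuous endomorphism induced by $\phi$ (with $V/W$ carrying the quotient topology).
   Context: $\mathbb K$ is an arbitrary field endowed with the discrete topology. A topological vector space over $\mathbb K$ is linearly topologized if it is Hausdorff and has a neighborhood basis at $0$ consisting of linear subspaces. A linear variety of $V$ is a coset $v+W$ of a linear subspace $W$; it is closed (open) if $W$ is closed (open). A linearly topologized vector space is linearly compact if every collection of closed linear varieties with the finite intersection property has non-empty intersection. A linearly topologized vector space is locally linearly compact (l.l.c.) if it has an open linear subspace that is linearly compact; $\mathcal B(V)$ denotes the family of all linearly compact open linear subspaces of $V$. Closed linear subspaces of an l.l.c. space, and quotients by them, are l.l.c. ''Endomorphism'' means linear endomorphism. For a continuous endomorphism $\phi$ of an l.l.c. space $V$, $U\in\mathcal B(V)$ and a positive integer $n$, let $T_n(\phi,U)=U+\phi U+\dots+\phi^{n-1}U$. Define $H(\phi,U)=\lim_{n\to\infty}\frac1n\dim\frac{T_n(\phi,U)}{U}$ (the limit exists) and the algebraic entropy $\mathrm{ent}(\phi)=\sup\{H(\phi,U)\mid U\in\mathcal B(V)\}\in\mathbb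 N\cup\{\infty\}$, with the usual conventions for sums involving $\infty$. *)

(* Defs.v *)
From HB Require Import structures.
From mathcomp Require Import all_boot all_order all_algebra generic_quotient.
From mathcomp Require Import all_classical reals topology.

Set Implicit Arguments.
Unset Strict Implicit.
Unset Printing Implicit Defensive.

Import Order.TTheory GRing.Theory Num.Theory.

Local Open Scope classical_set_scope.
Local Open Scope ring_scope.
Local Open Scope quotient_scope.

HB.mixin Record isDiscreteTvs (K : fieldType) V
    & Topological V & GRing.Lmodule K V := {
  dtvs_add_continuous : continuous (fun x : V * V => x.1 + x.2);
  dtvs_scale_continuous :
    continuous (fun z : discrete_topology K * V => (z.1 : K) *: z.2)
}.

(* Topological vector spaces over the discrete field K: the library's
   [topologicalLmodType] is restricted to scalars in a numDomainType. This
   structure has to be declared before the files on normed modules are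
   loaded, whence the second import below. *)
#[short(type="discreteTvsType")]
HB.structure Definition DiscreteTvs (K : fieldType) :=
  {V of Topological V & GRing.Lmodule K V & isDiscreteTvs K V}.

Section Subspace.
Context (K : fieldType) (V : discreteTvsType K) (W : submodClosed V).

(* The subspace W with the induced topology. *)
Definition lsub : Type := {x : V | x \in W}.

HB.instance Definition _ := SubChoice.on lsub.
HB.instance Definition _ := [SubChoice_isSubLmodule of lsub by <:].
HB.instance Definition _ :=
  Topological.copy lsub (initial_topology (val : lsub -> V)).

Lemma lsub_cvg (T : Type) (F : set_system T) (f : T -> lsub) (x : lsub) :
  Filter F -> (val \o f) @ F --> val x -> f @ F --> x.
Proof.
move=> FF fx A [B [/= [C oC <-]] Cx CA].
have FC := fx C (open_nbhs_nbhs (conj oC Cx)).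
suff : F (f @^-1` A) by [].
apply: (@filterS _ F FF ((val \o f) @^-1` C)); last exact: FC.
by move=> t; exact: CA.
Qed.

Lemma lsub_val_continuous : continuous (val : lsub -> V).
Proof. exact: initial_continuous. Qed.

Lemma lsub_add_continuous : continuous (fun x : lsub * lsub => x.1 + x.2).
Proof.
move=> x; apply: lsub_cvg.
apply: (@continuous_comp _ _ _ (fun y : lsub * lsub => (val y.1, val y.2))
  (fun y : V * V => y.1 + y.2)); last exact: dtvs_add_continuous.
by apply: cvg_pair; (apply: continuous_comp; last exact: lsub_val_continuous);
  [exact: cvg_fst|exact: cvg_snd].
Qed.

Lemma lsub_scale_continuous :
  continuous (fun z : discrete_topology K * lsub => (z.1 : K) *: z.2).
Proof.
move=> x; apply: lsub_cvg.
apply: (@continuous_comp _ _ _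
  (fun y : discrete_topology K * lsub => (y.1, val y.2))
  (fun y : discrete_topology K * V => (y.1 : K) *: y.2));
  last exact: dtvs_scale_continuous.
apply: (@cvg_pair _ _ _ _ (nbhs x.1)); first exact: cvg_fst.
by apply: continuous_comp; [exact: cvg_snd|exact: lsub_val_continuous].
Qed.

HB.instance Definition _ := isDiscreteTvs.Build K lsub
  lsub_add_continuous lsub_scale_continuous.

End Subspace.

Section QuotientSpace.
Context (K : fieldType) (V : discreteTvsType K) (W : submodClosed V).

(* [submodClosed] does not inherit from [zmodClosed], which the library's
   quotients [Quotient.quot] require. *)
Definition zmod_of : {pred V} := fun x => x \in W.

Lemma zmod_of_closed : zmod_closed zmod_of.
Proof. exact: GRing.submod_closedB (GRing.submodClosedP W). Qed.

HB.instance Definition _ := GRing.isZmodClosed.Build V zmod_of zmod_of_closed.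

(* V/W with the quotient topology. *)
Definition lquot : Type := quotient_topology (Quotient.quot zmod_of).

HB.instance Definition _ := Topological.on lquot.
HB.instance Definition _ := Quotient.on lquot.
HB.instance Definition _ := GRing.isZmodule.Build lquot
  (@Quotient.addqA V zmod_of) (@Quotient.addqC V zmod_of)
  (@Quotient.add0q V zmod_of) (@Quotient.addNq V zmod_of).

Lemma lquot_eqE (x y : V) : (\pi_lquot x == \pi_lquot y) = (x - y \in W).
Proof.
have WE := @Quotient.idealrBE V zmod_of x y.
apply/eqP/idP => [/eqP xy|xyW].
  by suff : x - y \in zmod_of by []; rewrite WE; apply/eqP/(elimT eqP xy).
by have /eqP : x == y %[mod Quotient.quot zmod_of] by rewrite -WE.
Qed.

Lemma lquot_piD (x y : V) : \pi_lquot (x + y) = \pi_lquot x + \pi_lquot y.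
Proof. exact: (@Quotient.pi_add V zmod_of). Qed.

Definition lquot_scale (a : K) (u : lquot) : lquot := \pi_lquot (a *: repr u).

Lemma lquot_piZ (a : K) (x : V) :
  \pi_lquot (a *: x) = lquot_scale a (\pi_lquot x).
Proof.
apply/eqP; rewrite lquot_eqE -scalerBr rpredZ// -lquot_eqE.
by rewrite reprK.
Qed.

Lemma lquot_scaleA a b u : lquot_scale a (lquot_scale b u) = lquot_scale (a * b) u.
Proof. by rewrite -[u]reprK -!lquot_piZ scalerA reprK. Qed.

Lemma lquot_scale1 : left_id 1 lquot_scale.
Proof. by move=> u; rewrite -[u]reprK -lquot_piZ scale1r. Qed.

Lemma lquot_scaleDr : right_distributive lquot_scale +%R.
Proof.
move=> a u v; rewrite -[u]reprK -[v]reprK -lquot_piD -!lquot_piZ -lquot_piD.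
by rewrite scalerDr.
Qed.

Lemma lquot_scaleDl u : {morph lquot_scale^~ u : a b / a + b}.
Proof. by move=> a b; rewrite -[u]reprK -!lquot_piZ scalerDl lquot_piD. Qed.

HB.instance Definition _ := GRing.Zmodule_isLmodule.Build K lquot
  lquot_scaleA lquot_scale1 lquot_scaleDr lquot_scaleDl.

Lemma lquot_pi_is_linear : linear (\pi_lquot : V -> lquot).
Proof. by move=> a x y; rewrite lquot_piD lquot_piZ. Qed.

Lemma lquot_pi_continuous : continuous (\pi_lquot : V -> lquot).
Proof. exact: (@pi_continuous V (Quotient.quot zmod_of)). Qed.

Lemma lquot_pi_open (A : set V) : open A -> open (\pi_lquot @` A : set lquot).
Proof.
move=> oA; suff : open ((\pi_lquot : V -> lquot) @^-1` (\pi_lquot @` A)) by [].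
rewrite (_ : _ @^-1` _ =
    \bigcup_(w in [set` W]) ((fun x : V => x + w) @^-1` A)); last first.
  apply/seteqP; split=> x /=.
    move=> [a Aa /eqP]; rewrite lquot_eqE => axW.
    by exists (a - x) => //=; rewrite addrC subrK.
  move=> [w /= wW Aw]; exists (x + w) => //; apply/eqP.
  by rewrite lquot_eqE addrC addKr.
apply: bigcup_open => w _; apply: open_comp oA => x _.
apply: (@continuous_comp _ _ _ (fun y : V => (y, w))
  (fun y : V * V => y.1 + y.2)); last exact: dtvs_add_continuous.
by apply: cvg_pair; [exact: cvg_id|exact: cvg_cst].
Qed.

Lemma lquot_pi_nbhs (x : V) (A : set V) :
  nbhs x A -> nbhs (\pi_lquot x : lquot) (\pi_lquot @` A).
Proof.
rewrite nbhsE => -[B [oB Bx] BA].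
apply: (@filterS _ (nbhs (\pi_lquot x : lquot)) _ _ _ (image_subset _ BA)).
apply: open_nbhs_nbhs; split.
  exact: lquot_pi_open.
by exists x.
Qed.

Lemma lquot_add_continuous : continuous (fun x : lquot * lquot => x.1 + x.2).
Proof.
move=> [u v] N /=; rewrite -[u]reprK -[v]reprK.
set x := repr u; set y := repr v => nN.
have : nbhs (x + y) ((\pi_lquot : V -> lquot) @^-1` N).
  by apply: lquot_pi_continuous; rewrite lquot_piD.
move=> /(dtvs_add_continuous (x, y))[[A B] /= [nA nB] AB].
exists (\pi_lquot @` A, \pi_lquot @` B) => /=.
  by split; exact: lquot_pi_nbhs.
move=> [_ _] /= [[a Aa <-] [b Bb <-]].
by have := AB (a, b) (conj Aa Bb); rewrite /= lquot_piD.
Qed.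

Lemma lquot_scale_continuous :
  continuous (fun z : discrete_topology K * lquot => (z.1 : K) *: z.2).
Proof.
move=> [a u] N /=; rewrite -[u]reprK; set x := repr u => nN.
have : nbhs (a *: x) ((\pi_lquot : V -> lquot) @^-1` N).
  by apply: lquot_pi_continuous; rewrite lquot_piZ.
move=> /(dtvs_scale_continuous (a, x))[[A B] /= [nA nB] AB].
exists (A, \pi_lquot @` B) => /=.
  by split; [exact: nA|exact: lquot_pi_nbhs].
move=> [c _] /= [Ac [b Bb <-]].
by have := AB (c, b) (conj Ac Bb); rewrite /= lquot_piZ.
Qed.

HB.instance Definition _ := isDiscreteTvs.Build K lquot
  lquot_add_continuous lquot_scale_continuous.

End QuotientSpace.

From mathcomp Require Import ereal normedtype sequences.

Section LinearlyCompact.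
Context (K : fieldType).

Definition linearly_topologized (X : discreteTvsType K) : Prop :=
  hausdorff_space X /\
  forall N : set X, nbhs 0 N ->
    exists2 W : submodClosed X, nbhs 0 [set` W] & [set` W] `<=` N.

Definition closed_linear_variety (X : discreteTvsType K) (A : set X) : Prop :=
  exists (v : X) (W : submodClosed X),
    closed [set` W] /\ A = [set v + w | w in [set` W]].

Definition linearly_compact (X : discreteTvsType K) : Prop :=
  linearly_topologized X /\
  forall F : set (set X),
    F `<=` @closed_linear_variety X -> finI F id -> \bigcap_(A in F) A !=set0.

(* The family B(V). *)
Definition lc_open (V : discreteTvsType K) : set (submodClosed V) :=
  [set U : submodClosed V | open [set` U] /\ linearly_compact (lsub U)].

Definition locally_linearly_compact (V : discreteTvsType K) : Prop :=
  linearly_topologized V /\ @lc_open V !=set0.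

End LinearlyCompact.

Arguments lc_open {K} V _.

Definition is_basis (K : fieldType) (X : lmodType K) n (b : 'I_n -> X) : Prop :=
  forall x : X, exists! c : {ffun 'I_n -> K}, x = \sum_(i < n) c i *: b i.

(* The set below has at most one element (invariance of dimension); it is
   empty, with infimum +oo, when X has no finite basis. *)
Definition dim (R : realType) (K : fieldType) (X : lmodType K) : \bar R :=
  ereal_inf
    [set n%:R%:E | n in [set n : nat | exists b : 'I_n -> X, is_basis b]].

Section RelativeSubspace.
Context (K : fieldType) (V : discreteTvsType K) (T U : submodClosed V).

(* The intersection of T and U, as a subspace of the space T. *)
Definition sub_in : {pred lsub T} := fun x => val x \in U.

Lemma sub_in_closed : subsemimod_closed sub_in.
Proof.
have E (x : lsub T) : (x \in sub_in) = (val x \in U) by [].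
split; first split => [|x y]; rewrite ?E.
- by rewrite raddf0 rpred0.
- by rewrite raddfD; exact: rpredD.
- by move=> a x; rewrite !E linearZ; exact: rpredZ.
Qed.

HB.instance Definition _ :=
  GRing.isSubmodClosed.Build K (lsub T) sub_in sub_in_closed.

End RelativeSubspace.

Arguments sub_in {K V} T U _.

Section Entropy.
Context (K : fieldType) (V : discreteTvsType K) (phi : {linear V -> V}).
Implicit Type U : submodClosed V.

(* T_n(phi, U) = U + phi U + ... + phi^(n-1) U *)
Definition traj U (n : nat) : {pred V} := fun x =>
  `[< exists2 u : 'I_n -> V, (forall i, u i \in U)
      & x = \sum_(i < n) iter i phi (u i) >].

Lemma iter_linear n : linear (iter n phi).
Proof. by elim: n => // n IHn a x y; rewrite !iterS IHn linearP. Qed.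

Lemma traj_closed U n : subsemimod_closed (traj U n).
Proof.
split.
  split.
    apply/asboolP; exists (fun=> 0) => [i|]; first exact: rpred0.
    rewrite big1// => i _; have := iter_linear i (-1) 0 0.
    by rewrite scaler0 addr0 scaleN1r addNr.
  move=> x y /asboolP[u uU ->] /asboolP[v vU ->]; apply/asboolP.
  exists (fun i => u i + v i) => [i|]; first exact: rpredD.
  rewrite -big_split; apply: eq_bigr => i _ /=.
  by have := iter_linear i 1 (u i) (v i); rewrite !scale1r.
move=> a x /asboolP[u uU ->]; apply/asboolP.
exists (fun i => a *: u i) => [i|]; first exact: rpredZ.
rewrite scaler_sumr; apply: eq_bigr => i _.
have i0 : iter i phi 0 = 0.
  have := iter_linear i (-1) 0 0.
  by rewrite scaler0 addr0 scaleN1r addNr.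
by have := iter_linear i a (u i) 0; rewrite i0 !addr0.
Qed.

HB.instance Definition _ U n :=
  GRing.isSubmodClosed.Build K V (traj U n) (traj_closed U n).

(* For n > 0, U is contained in T_n, so that [sub_in T_n U] is U itself; the
   term n = 0 plays no role in the limit. *)
Definition entropy_at (R : realType) U : \bar R :=
  limn (fun n : nat =>
    (n%:R^-1)%:E * dim R (lquot (sub_in (traj U n) U)))%E.

Definition ent (R : realType) : \bar R :=
  ereal_sup [set entropy_at R U | U in lc_open V].

End Entropy.

Arguments entropy_at {K V} phi R U.
Arguments ent {K V} phi R.

Section Restriction.
Context (K : fieldType) (V : discreteTvsType K).
Context (phi : {linear V -> V}) (W : submodClosed V).
Context (phiW : {in W, forall x, phi x \in W}).

Definition restr (x : lsub W) : lsub W := Sub (phi (val x)) (phiW (valP x)).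

Lemma restr_is_linear : linear restr.
Proof. by move=> a x y; apply: val_inj; rewrite /= !linearP. Qed.

HB.instance Definition _ := GRing.isLinear.Build K (lsub W) (lsub W) *:%R
  restr restr_is_linear.

Lemma restr_continuous : continuous phi -> continuous restr.
Proof.
move=> cphi x; apply: (@lsub_cvg _ _ _ _ (nbhs x)).
have cx : {for x, continuous (phi \o (val : lsub W -> V))}.
  by apply: continuous_comp; [exact: lsub_val_continuous|exact: cphi].
exact: cx.
Qed.

End Restriction.

(* The invariance proof is not used in the definition itself, but the
   canonical linear structure on [induced phiW] depends on it. *)
Definition induced (K : fieldType) (V : discreteTvsType K)
    (phi : {linear V -> V}) (W : submodClosed V)
    (phiW : {in W, forall x, phi x \in W}) (u : lquot W) : lquot W :=
  \pi_(lquot W) (phi (repr u)).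

Section Induced.
Context (K : fieldType) (V : discreteTvsType K).
Context (phi : {linear V -> V}) (W : submodClosed V).
Context (phiW : {in W, forall x, phi x \in W}).

Lemma induced_pi (x : V) :
  induced phiW (\pi_(lquot W) x) = \pi_(lquot W) (phi x).
Proof.
apply/eqP; rewrite lquot_eqE -linearB phiW// -lquot_eqE.
by rewrite reprK.
Qed.

Lemma induced_is_linear : linear (induced phiW).
Proof.
move=> a u v; rewrite -[u]reprK -[v]reprK -lquot_pi_is_linear !induced_pi.
by rewrite -lquot_pi_is_linear linearP.
Qed.

HB.instance Definition _ := GRing.isLinear.Build K (lquot W) (lquot W) *:%R
  (induced phiW) induced_is_linear.

Lemma induced_continuous : continuous phi -> continuous (induced phiW).
Proof.
move=> cphi; apply/quotient_continuous => x.
rewrite (_ : _ \o _ = (\pi_(lquot W) : V -> lquot W) \o phi); last first.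
  by apply/funext => y /=; exact: induced_pi.
by apply: continuous_comp; [exact: cphi|exact: lquot_pi_continuous].
Qed.

End Induced.

(* Main.v *)
(* For [U] in B(V) the dimensions of [T_(n+1) / T_n] are finite and
   nonincreasing, because [phi] maps [T_n / T_(n-1)] onto [T_(n+1) / T_n];
   hence they are eventually equal to some [h], and [H(phi, U) = h]. The same
   applies to the images of the [T_n] in [V / W], so for large [n] the map
   induced by [phi] on [(T_n + W) / (T_(n-1) + W)] is injective. This gives
   [T_(n+1) /\ W = phi(T_n /\ W) + T_n /\ W]: replacing [U] by some [U' = T_m],
   which does not change [H(phi, U)], the trajectory of [U' /\ W] is the trace
   on [W] of the trajectory of [U'], so that
   [H(phi, U) = H(phi|W, U' /\ W) + H(phi-bar, (U' + W) / W)].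
   It remains to take suprema: [H(phi, U)] increases with [U], and the pairs
   [(U /\ W, (U + W) / W)] are cofinal in [B(W) x B(V / W)], since any linearly
   compact subspace is finite dimensional modulo an open one. *)

Require Import Defs.
From HB Require Import structures.
From mathcomp Require Import all_boot all_order all_algebra generic_quotient.
From mathcomp Require Import finmap.
From mathcomp Require Import all_classical reals topology.
From mathcomp Require Import ereal normedtype sequences.
From mathcomp Require Import zify.

Set Implicit Arguments.
Unset Strict Implicit.
Unset Printing Implicit Defensive.

Import Order.TTheory GRing.Theory Num.Theory.
Import numFieldNormedType.Exports.

Local Open Scope classical_set_scope.
Local Open Scope ring_scope.

(** * Subspaces, spans and dimension relative to a subspace *)

Section LinearSets.
Context (K : fieldType) (V : lmodType K).
Implicit Types A B C D : set V.

(** Subspaces are kept as plain sets, so that sums, images and preimages can be formed freely;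
    [lin_submodE] bundles them again. *)
Definition lin A := A 0 /\ forall a x y, A x -> A y -> A (a *: x + y).

Definition sadd A B : set V := [set a + b | a in A & b in B].

Definition line (x : V) : set V := [set a *: x | a in setT].

Lemma lin0 A : lin A -> A 0.
Proof. by case. Qed.

Lemma linD A x y : lin A -> A x -> A y -> A (x + y).
Proof. by move=> [_ lA] Ax Ay; rewrite -[x]scale1r; exact: lA. Qed.

Lemma linZ A a x : lin A -> A x -> A (a *: x).
Proof. by move=> [A0 lA] Ax; rewrite -[_ *: _]addr0; exact: lA. Qed.

Lemma linN A x : lin A -> A x -> A (- x).
Proof. by move=> lA Ax; rewrite -scaleN1r; exact: linZ. Qed.

Lemma linB A x y : lin A -> A x -> A y -> A (x - y).
Proof. by move=> lA Ax Ay; apply: linD => //; exact: linN. Qed.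

Lemma lin_sum A n (F : 'I_n -> V) :
  lin A -> (forall i, A (F i)) -> A (\sum_(i < n) F i).
Proof. by move=> lA AF; apply: (big_ind A) => //; [exact: lin0|move=> *; exact: linD]. Qed.

Lemma lin_submod (U : submodClosed V) : lin [set` U].
Proof.
by split=> [|a x y /= xU yU]; [exact: rpred0|apply: rpredD => //; exact: rpredZ].
Qed.

Lemma lin_set0 : lin [set (0 : V)].
Proof. by split=> // a x y /= -> ->; rewrite scaler0 addr0. Qed.

Lemma lin_line x : lin (line x).
Proof.
split=> [|a _ _ [b _ <-] [c _ <-]]; first by exists 0 => //; rewrite scale0r.
by exists (a * b + c) => //; rewrite scalerDl scalerA.
Qed.

Lemma lin_setI A B : lin A -> lin B -> lin (A `&` B).
Proof.
move=> [A0 lA] [B0 lB]; split=> // a x y [Ax Bx] [Ay By].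
by split; [exact: lA|exact: lB].
Qed.

Lemma lin_sadd A B : lin A -> lin B -> lin (sadd A B).
Proof.
move=> lA lB; split=> [|c _ _ [x Ax [y By <-]] [x' Ax' [y' By' <-]]].
  by exists 0; [exact: lin0|exists 0; [exact: lin0|rewrite addr0]].
exists (c *: x + x'); first exact: lA.2.
exists (c *: y + y'); first exact: lB.2.
by rewrite scalerDr addrACA.
Qed.

Lemma sadd_subl A B : lin B -> A `<=` sadd A B.
Proof. by move=> lB x Ax; exists x => //; exists 0; [exact: lin0|rewrite addr0]. Qed.

Lemma sadd_subr A B : lin A -> B `<=` sadd A B.
Proof. by move=> lA x Ax; exists 0; [exact: lin0|exists x => //; rewrite add0r]. Qed.

Lemma sadd_sub A B C : lin C -> A `<=` C -> B `<=` C -> sadd A B `<=` C.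
Proof. by move=> lC sAC BC _ [x Ax [y By <-]]; apply: linD; [|exact: sAC|exact: BC]. Qed.

Lemma sadd_mono A B C D : A `<=` C -> B `<=` D -> sadd A B `<=` sadd C D.
Proof. by move=> sAC BD _ [x Ax [y By <-]]; exists x; [exact: sAC|exists y => //; exact: BD]. Qed.

Lemma saddC A B : sadd A B = sadd B A.
Proof.
by apply/seteqP; split=> _ [x Ax [y By <-]]; exists y => //; exists x => //; rewrite addrC.
Qed.

Lemma saddA A B C : sadd A (sadd B C) = sadd (sadd A B) C.
Proof.
apply/seteqP; split=> [_ [x Ax [_ [y By [z Cz <-]] <-]]|_ [_ [x Ax [y By <-]] [z Cz <-]]].
  by exists (x + y); [exists x => //; exists y|exists z => //; rewrite addrA].
by exists x => //; exists (y + z); [exists y => //; exists z|rewrite addrA].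
Qed.

Lemma line_id x : line x x.
Proof. by exists 1 => //; rewrite scale1r. Qed.

Lemma line_sub A x : lin A -> A x -> line x `<=` A.
Proof. by move=> lA Ax _ [a _ <-]; exact: linZ. Qed.

Definition span_mod B (s : seq V) : set V := foldr (fun x E => sadd E (line x)) B s.

(** Independence modulo [B], one vector at a time: each lies outside [B] plus the span of the
    entries after it. For linear [B], [free_modP] gives the form with coefficients. *)
Fixpoint free_mod B (s : seq V) : Prop :=
  if s is x :: s' then free_mod B s' /\ ~ span_mod B s' x else True.

Lemma lin_span_mod B s : lin B -> lin (span_mod B s).
Proof. by move=> lB; elim: s => //= x s IH; apply: lin_sadd => //; exact: lin_line. Qed.

Lemma span_mod_sub B s : B `<=` span_mod B s.
Proof. by elim: s => //= x s IH; apply: subset_trans IH (sadd_subl _); exact: lin_line. Qed.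

Lemma span_mod_mem B s x : lin B -> x \in s -> span_mod B s x.
Proof.
move=> lB; elim: s => //= y s IH; rewrite in_cons => /predU1P[->|/IH xs].
  by apply: (sadd_subr (lin_span_mod s lB)); exact: line_id.
by apply: sadd_subl xs; exact: lin_line.
Qed.

Lemma span_mod_least B s C :
  lin C -> B `<=` C -> (forall x, x \in s -> C x) -> span_mod B s `<=` C.
Proof.
move=> lC BC; elim: s => //= x s IH sC; apply: sadd_sub => //.
  by apply: IH => y ys; apply: sC; rewrite in_cons ys orbT.
by apply: line_sub => //; apply: sC; rewrite mem_head.
Qed.

Lemma span_mod_mono A B s : A `<=` B -> span_mod A s `<=` span_mod B s.
Proof. by move=> AB; elim: s => //= x s IH; exact: sadd_mono. Qed.

Lemma span_mod_cat B s t : span_mod B (s ++ t) = span_mod (span_mod B t) s.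
Proof. by rewrite /span_mod foldr_cat. Qed.

Lemma free_mod_cat B s t :
  free_mod B (s ++ t) <-> free_mod (span_mod B t) s /\ free_mod B t.
Proof. by elim: s => [|x s IH] /=; [tauto|rewrite IH span_mod_cat; tauto]. Qed.

Lemma free_mod_anti A B s : A `<=` B -> free_mod B s -> free_mod A s.
Proof.
move=> AB; elim: s => //= x s IH [/IH ? xs]; split=> // h; apply: xs.
exact: span_mod_mono h.
Qed.

Lemma span_modP B s y : span_mod B s y <->
  exists c : nat -> K, B (y - \sum_(i < size s) c i *: s`_i).
Proof.
elim: s y => [|x s IH] y /=.
  split=> [By|[c]]; rewrite ?big_ord0 ?subr0//.
  by exists (fun=> 0) => //; rewrite big_ord0 subr0.
split.
  move=> [z /IH[c Bc] [_ [a _ <-] <-]].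
  exists (fun i => if i is j.+1 then c j else a).
  by rewrite big_ord_recl /= opprD addrA addrK.
move=> [c]; rewrite big_ord_recl /= => Bc.
exists (y - c 0 *: x); last by exists (c 0 *: x); [exists (c 0)|rewrite subrK].
by apply/IH; exists (c \o succn); rewrite -addrA -opprD.
Qed.

Lemma free_modP B s : lin B -> free_mod B s <->
  (forall c : nat -> K, B (\sum_(i < size s) c i *: s`_i) ->
    forall i, (i < size s)%N -> c i = 0).
Proof.
move=> lB; elim: s => [|x s IH] //=; split.
  move=> [/IH fs xs] c; rewrite big_ord_recl /= => Bc.
  have c0 : c 0%N = 0.
    apply: contrapT => /eqP c0; apply: xs; apply/span_modP.
    exists (fun i => - ((c 0)^-1 * c i.+1)).
    have := linZ (c 0)^-1 lB Bc; rewrite scalerDr scalerA mulVf// scale1r.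
    rewrite -sumrN scaler_sumr; congr (B (_ + _)).
    by apply: eq_bigr => i _; rewrite scaleNr opprK scalerA.
  move: Bc; rewrite c0 scale0r add0r => /(fs (c \o succn)) h [|i]//.
  by rewrite ltnS; exact: h.
move=> h; split.
  apply/IH => c Bc i si; apply: (h (fun i => if i is j.+1 then c j else 0) _ i.+1) => //.
  by rewrite big_ord_recl /= scale0r add0r.
move/span_modP => [c Bc].
have := h (fun i => if i is j.+1 then - c j else 1) _ 0%N isT.
rewrite big_ord_recl /= scale1r => h'.
have /eqP : (1 : K) = 0.
  apply: h'; move: Bc; rewrite -sumrN; congr (B (_ + _)).
  by apply: eq_bigr => i _; rewrite scaleNr.
by rewrite oner_eq0.
Qed.

(** Were [t] longer than [s], the coefficient matrix of [t] over [s] modulo [B] would have more rows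
    than columns, and a nonzero row vector killing it would be a nontrivial relation among [t]
    modulo [B]. *)
Lemma steinitz B s t : lin B -> free_mod B t ->
  (forall x, x \in t -> span_mod B s x) -> (size t <= size s)%N.
Proof.
move=> lB /(free_modP _ lB) ft ts.
have [//|lt_st] := leqP (size t) (size s).
have /choice[c cP] : forall j : 'I_(size t), exists c : nat -> K,
    B (t`_j - \sum_(i < size s) c i *: s`_i).
  move=> j; have /span_modP[c ?] := ts _ (mem_nth 0 (ltn_ord j)).
  by exists c.
pose M : 'M[K]_(size t, size s) := \matrix_(j, i) c j i.
have : kermx M != 0.
  rewrite kermx_eq0 /row_free neq_ltn; apply/orP; left.
  by apply: leq_ltn_trans lt_st; exact: rank_leq_col.
move=> /rowV0Pn[v vM vn0]; case/eqP: vn0.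
have {}vM : v *m M = 0 by exact/sub_kermxP.
(* [insub] extends [v] by zero to coefficients indexed by [nat], as [free_modP] expects. *)
have Bv : B (\sum_(j < size t) (if insub (j : nat) is Some i then v 0 i else 0) *: t`_j).
  have : B (\sum_(j < size t) v 0 j *: (t`_j - \sum_(i < size s) c j i *: s`_i)).
    by apply: lin_sum => // j; apply: linZ => //; exact: cP.
  rewrite (eq_bigr (fun j : 'I__ => v 0 j *: t`_j - \sum_(i < size s) (v 0 j * c j i) *: s`_i)); last first.
    move=> j _; rewrite scalerBr; congr (_ - _); rewrite scaler_sumr.
    by apply: eq_bigr => i _; rewrite scalerA.
  rewrite big_split /= sumrN exchange_big /= [X in _ - X]big1 ?subr0.
    by congr (B _); apply: eq_bigr => j _; rewrite valK.
  move=> i _; rewrite -scaler_suml.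
  have -> : \sum_j v 0 j * c j i = (v *m M) 0 i.
    by rewrite mxE; apply: eq_bigr => j _; rewrite mxE.
  by rewrite vM mxE scale0r.
apply/rowP => j; rewrite mxE.
have := ft (fun j => if insub j is Some i then v 0 i else 0) Bv j (ltn_ord j).
by rewrite valK.
Qed.

Definition basis_mod A B (s : seq V) :=
  [/\ forall x, x \in s -> A x, free_mod B s & A `<=` span_mod B s].

(* [rdim A B n] means that [(A + B) / B] has dimension [n]. *)
Definition rdim A B n := exists2 s, size s = n & basis_mod A B s.

Lemma rdim_le A A' B n n' : lin B -> A `<=` A' ->
  rdim A B n -> rdim A' B n' -> (n <= n')%N.
Proof.
move=> lB AA' [s <- [sA sf _]] [t <- [_ _ A't]].
by apply: (steinitz lB sf) => x /sA/AA'/A't.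
Qed.

Lemma rdim_uniq A B n n' : lin B -> rdim A B n -> rdim A B n' -> n = n'.
Proof. by move=> lB h h'; apply/eqP; rewrite eqn_leq !(@rdim_le A A B). Qed.

Lemma free_mod_extend A B s : lin B -> (forall x, x \in s -> A x) ->
  free_mod B s -> (~ exists n, rdim A B n) ->
  exists x, A x /\ ~ span_mod B s x.
Proof.
move=> lB sA sf nd; apply: contrapT => h; apply: nd; exists (size s), s => //.
by split=> // x Ax; apply: contrapT => xs; apply: h; exists x.
Qed.

(** By [steinitz], free families in [A] have at most [size s] elements, so extending them vector by
    vector must end in a basis. *)
Lemma rdim_exists A B s : lin B -> A `<=` span_mod B s ->
  exists2 n, rdim A B n & (n <= size s)%N.
Proof.
move=> lB As; suff [n dn] : exists n, rdim A B n.
  exists n => //; have [t <- [tA tf _]] := dn.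
  by apply: (steinitz lB tf) => x /tA/As.
apply: contrapT => nd.
suff /(_ (size s).+1)[t [tA tf st]] : forall n, exists t,
    [/\ forall x, x \in t -> A x, free_mod B t & size t = n].
  have := steinitz lB tf (fun x xt => As x (tA x xt)).
  by rewrite st ltnn.
elim=> [|n [t [tA tf <-]]]; first by exists [::].
have [x [Ax xt]] := free_mod_extend lB tA tf nd.
exists (x :: t); split=> // y; rewrite in_cons => /predU1P[->//|]; exact: tA.
Qed.

(** A basis of [A] modulo [B] followed by one of [B] modulo [C] is a basis of [A] modulo [C]. *)
Lemma rdim_trans A B C m n : lin B -> C `<=` B -> B `<=` A ->
  rdim A B m -> rdim B C n -> rdim A C (m + n).
Proof.
move=> lB CB BA [s <- [sA sf As]] [t <- [tB tf Bt]].
exists (s ++ t); first by rewrite size_cat.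
split.
- by move=> x; rewrite mem_cat => /orP[/sA//|/tB/BA].
- rewrite free_mod_cat; split=> //; apply: free_mod_anti sf.
  exact: span_mod_least.
- by rewrite span_mod_cat; apply: subset_trans As _; exact: span_mod_mono.
Qed.

Lemma rdim_sadd A B C n : lin B -> C `<=` B -> C 0 ->
  rdim A B n <-> rdim (sadd A C) B n.
Proof.
move=> lB CB C0; have AAC : A `<=` sadd A C.
  by move=> x Ax; exists x => //; exists 0 => //; rewrite addr0.
have ext m : rdim A B m -> rdim (sadd A C) B m.
  move=> [s <- [sA sf As]]; exists s => //; split=> // [x /sA/AAC//|].
  apply: sadd_sub => //; first exact: lin_span_mod.
  by apply: subset_trans CB _; exact: span_mod_sub.
split=> [|dAC]; first exact: ext.
have [s _ [_ _ As]] := dAC.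
have [m dA _] := rdim_exists lB (subset_trans AAC As).
by rewrite (rdim_uniq lB dAC (ext _ dA)).
Qed.

Lemma rdim_line B x : lin B -> ~ B x -> rdim (sadd B (line x)) B 1.
Proof.
move=> lB Bx; exists [:: x] => //; split => // y; rewrite inE => /eqP ->.
by apply: sadd_subr => //; exact: line_id.
Qed.

End LinearSets.

(** * Images and preimages under a linear map *)

Section LinearMaps.
Context (K : fieldType) (X Y : lmodType K) (f : {linear X -> Y}).

Lemma lin_image (A : set X) : lin A -> lin (f @` A).
Proof.
move=> lA; split=> [|a _ _ [x Ax <-] [y Ay <-]].
  by exists 0; [exact: lin0|rewrite linear0].
by exists (a *: x + y); [exact: lA.2|rewrite linearP].
Qed.

Lemma lin_preimage (B : set Y) : lin B -> lin (f @^-1` B).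
Proof.
move=> lB; split=> [|a x y Bx By] /=; first by rewrite linear0; exact: lin0.
by rewrite linearP; exact: lB.2.
Qed.

Lemma image_sadd (A B : set X) : f @` (sadd A B) = sadd (f @` A) (f @` B).
Proof.
apply/seteqP; split=> [_ [_ [x Ax [y By <-]] <-]|_ [_ [x Ax <-] [_ [y By <-] <-]]].
  by exists (f x); [exists x|exists (f y); [exists y|rewrite linearD]].
by exists (x + y); [exists x => //; exists y|rewrite linearD].
Qed.

Lemma image_line (x : X) : f @` line x = line (f x).
Proof.
apply/seteqP; split=> [_ [_ [a _ <-] <-]|_ [a _ <-]]; first by exists a; rewrite ?linearZ.
by exists (a *: x); [exists a|rewrite linearZ].
Qed.

(** The added vectors are images, so subtracting multiples of them in the target can be done in the
    source. *)
Lemma preimage_span_mod (B : set Y) (s : seq X) :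
  f @^-1` (span_mod B (map f s)) = span_mod (f @^-1` B) s.
Proof.
elim: s => //= x s IH; rewrite -IH; apply/seteqP; split.
  move=> y /= [z Bz [_ [a _ <-] zy]].
  exists (y - a *: x); last by exists (a *: x); [exists a|rewrite subrK].
  by rewrite /= linearB linearZ -zy addrK.
move=> _ [z /= Bz [_ [a _ <-] <-]] /=; rewrite linearD.
by exists (f z) => //; exists (f (a *: x)) => //; exists a => //; rewrite linearZ.
Qed.

Lemma free_mod_map (B : set Y) (s : seq X) :
  free_mod B (map f s) <-> free_mod (f @^-1` B) s.
Proof.
elim: s => //= x s IH; have := preimage_span_mod B s.
by move=> /(congr1 (fun A => A x)) /= ->; rewrite IH.
Qed.

(** [f] induces an isomorphism from [(A + f^-1 B) / f^-1 B] to [(f A + B) / B]; bases of the latter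
    are lifted to [A]. *)
Lemma rdim_image (A : set X) (B : set Y) n :
  rdim (f @` A) B n <-> rdim A (f @^-1` B) n.
Proof.
split=> [[t <- [tA tf At]]|[s <- [sA sf As]]]; last first.
  exists (map f s); first by rewrite size_map.
  split=> [_ /mapP[x xs ->]||_ [x /As + <-]]; first by exists x => //; exact: sA.
    by rewrite free_mod_map.
  by rewrite -preimage_span_mod.
have [s sA ts] : exists2 s, (forall x, x \in s -> A x) & map f s = t.
  elim: t tA {tf At} => [|y t IH] tA; first by exists [::].
  have [x Ax xy] := tA y (mem_head _ _).
  have [|s sA st] := IH; first by move=> z zt; apply: tA; rewrite in_cons zt orbT.
  exists (x :: s); last by rewrite /= xy st.
  by move=> z; rewrite in_cons => /predU1P[->//|]; exact: sA.
exists s; first by rewrite -ts size_map.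
rewrite -ts in tf At; split => //; first by rewrite -free_mod_map.
by move=> x Ax; rewrite -preimage_span_mod; apply: At; exists x.
Qed.

End LinearMaps.

(** * Agreement of the relative dimension with [dim] *)

Section Dimension.
Context (R : realType) (K : fieldType).

Lemma is_basis_rdim (X : lmodType K) n (b : 'I_n -> X) :
  is_basis b -> rdim [set: X] [set 0] n.
Proof.
move=> bb; have nthb (i : 'I_n) : (codom b)`_i = b i.
  have := @nth_codom _ _ 0 b (enum_rank i).
  rewrite enum_rankK => <-; congr nth.
  by rewrite [RHS]/= -{1}[i]enum_rankK enum_val_ord.
have sb : size (codom b) = n by rewrite size_codom card_ord.
exists (codom b) => //; split=> //.
  apply/free_modP; first exact: lin_set0.
  rewrite sb => c /= c0 i ltin.
  have [c' [_ uc']] := bb 0.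
  have /ffunP/(_ (Ordinal ltin)) : [ffun i : 'I_n => c i] = [ffun=> 0].
    rewrite -(uc' [ffun i : 'I_n => c i]); last first.
      rewrite -[LHS]c0; apply: eq_bigr => j _; rewrite ffunE.
      by rewrite nthb.
    apply: uc'; rewrite big1// => j _.
    by rewrite ffunE scale0r.
  by rewrite !ffunE.
move=> x _; have [c [xc _]] := bb x.
apply/span_modP; exists (fun i => if insub i is Some j then c j else 0).
apply/eqP; rewrite sb xc subr_eq0; apply/eqP; apply: eq_bigr => j _.
by rewrite valK nthb.
Qed.

Lemma rdim_is_basis (X : lmodType K) n :
  rdim [set: X] [set 0] n -> exists b : 'I_n -> X, is_basis b.
Proof.
move=> [s <- [_ fs Xs]]; exists (fun i => s`_i) => x.
have /span_modP[c /= /eqP] := Xs x I; rewrite subr_eq0 => /eqP xc.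
exists [ffun i : 'I__ => c i]; split.
  by rewrite xc; apply: eq_bigr => i _; rewrite ffunE.
move=> c' xc'; apply/ffunP => i; rewrite ffunE.
have /(free_modP _ (@lin_set0 _ _)) h := fs.
pose d (i : nat) := c i - if insub i is Some j then c' j else 0.
apply/eqP; rewrite -subr_eq0; apply/eqP.
have := h d _ i (ltn_ord i); rewrite /d valK; apply.
rewrite (eq_bigr (fun i : 'I__ => c i *: s`_i - c' i *: s`_i)); last first.
  by move=> j _; rewrite valK scalerBl.
by rewrite sumrB -xc -xc' subrr.
Qed.

Lemma dimE (X : lmodType K) n : rdim [set: X] [set 0] n -> Defs.dim R X = n%:R%:E.
Proof.
move=> dX; rewrite /Defs.dim (_ : [set _ | _ in _] = [set n%:R%:E]) ?ereal_inf1//.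
apply/seteqP; split=> [_ [m [b /is_basis_rdim bb] <-]|_ ->].
  by rewrite (rdim_uniq (@lin_set0 _ _) bb dX).
by exists n => //; exact: rdim_is_basis.
Qed.

End Dimension.

(** * The projection to a quotient and the inclusion of a subspace *)

Section Projection.
Context (K : fieldType) (V : discreteTvsType K) (W : submodClosed V).

Definition lproj : V -> lquot W := \pi_(lquot W)%qT.

HB.instance Definition _ :=
  GRing.isLinear.Build K V (lquot W) *:%R lproj (@lquot_pi_is_linear K V W).

Lemma lproj_eq0 x : (lproj x = 0) <-> x \in W.
Proof.
rewrite -(linear0 lproj); split=> [/eqP|xW]; first by rewrite lquot_eqE subr0.
by apply/eqP; rewrite lquot_eqE subr0.
Qed.

Lemma lproj_surj u : exists x, lproj x = u.
Proof. by exists (repr u); rewrite /lproj reprK. Qed.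

Lemma image_lproj_setT : lproj @` setT = setT.
Proof. by apply/seteqP; split=> // u _; have [x <-] := lproj_surj u; exists x. Qed.

Lemma preimage_image_lproj (A : set V) : lproj @^-1` (lproj @` A) = sadd A [set` W].
Proof.
apply/seteqP; split=> [x [a Aa /= ax]|_ [a Aa [w /= wW <-]]].
  exists a => //; exists (x - a); last by rewrite addrC subrK.
  by apply/lproj_eq0; rewrite linearB /= ax subrr.
by exists a => //=; rewrite linearD /= (lproj_eq0 w).2 ?addr0.
Qed.

Lemma lproj_continuous : continuous lproj.
Proof. exact: lquot_pi_continuous. Qed.

Lemma lproj_open (A : set V) : open A -> open (lproj @` A).
Proof. exact: lquot_pi_open. Qed.

End Projection.

Section SubspaceInclusion.
Context (K : fieldType) (V : discreteTvsType K) (W : submodClosed V).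

Definition linc : lsub W -> V := val.

HB.instance Definition _ :=
  GRing.isLinear.Build K (lsub W) V *:%R linc (fun a x y => erefl).

Lemma image_linc_setT : linc @` setT = [set` W].
Proof.
apply/seteqP; split=> [_ [x _ <-]|x xW]; first exact: valP.
by exists (Sub x xW).
Qed.

Lemma image_linc_sub_in (U : submodClosed V) :
  linc @` [set` sub_in W U] = [set` U] `&` [set` W].
Proof.
apply/seteqP; split=> [_ [x xU <-]|x [xU xW]]; first by split; [exact: xU|exact: valP].
by exists (Sub x xW).
Qed.

Lemma linc_inj : injective linc.
Proof. exact: val_inj. Qed.

End SubspaceInclusion.

(** [rdim_image] is used twice: along the projection of [lsub T] onto its quotient and along the
    inclusion of [T] in [V]. This links the dimensions in [entropy_at] to [rdim]. *)
Lemma dim_lquot_sub_in (R : realType) (K : fieldType) (V : discreteTvsType K)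
    (T U : submodClosed V) n :
  rdim [set` T] [set` U] n -> Defs.dim R (lquot (sub_in T U)) = n%:R%:E.
Proof.
move=> TU; apply: dimE; rewrite -image_lproj_setT.
apply/rdim_image; rewrite (_ : _ @^-1` _ = @linc _ _ T @^-1` [set` U]).
  by apply/rdim_image; rewrite image_linc_setT.
by apply/seteqP; split=> x /=; rewrite lproj_eq0.
Qed.

(** * Maps induced between quotients of subspaces *)

Section InducedOnQuotients.
Context (K : fieldType) (X Y : lmodType K) (f : {linear X -> Y}).
Implicit Types (A B : set X) (C D : set Y).

(** The hypotheses on [f] make it induce a map on [(A + B) / B] whose image covers [C] modulo [D],
    so images of generators generate. *)
Lemma image_span_mod_sub A B D C s : lin D -> f @` B `<=` D ->
  C `<=` sadd D (f @` A) -> A `<=` span_mod B s ->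
  C `<=` span_mod D (map f s).
Proof.
move=> lD fB CA As; apply: subset_trans CA _.
apply: sadd_sub; [exact: lin_span_mod|exact: span_mod_sub|].
move=> _ [x /As xs <-]; suff : (f @^-1` span_mod D (map f s)) x by [].
rewrite preimage_span_mod; apply: span_mod_mono xs => y By.
by apply: fB; exists y.
Qed.

Lemma rdim_image_le A B D C n : lin D -> f @` B `<=` D ->
  C `<=` sadd D (f @` A) -> rdim A B n ->
  exists2 m, rdim C D m & (m <= n)%N.
Proof.
move=> lD fB CA [s <- [_ _ /(image_span_mod_sub lD fB CA) Cs]].
by have := rdim_exists lD Cs; rewrite size_map.
Qed.

(* A surjection between spaces of the same finite dimension is injective. *)
Lemma rdim_image_inj A B D C n x : lin A -> lin B -> lin D ->
  f @` B `<=` D -> C `<=` sadd D (f @` A) -> rdim A B n -> rdim C D n ->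
  B `<=` A -> A x -> D (f x) -> B x.
Proof.
move=> lA lB lD fB CA dA dC BA Ax fx; apply: contrapT => Bx.
have lx := @lin_line _ _ x; have lBx := lin_sadd lB lx.
have xA : sadd B (line x) `<=` A by apply: sadd_sub => //; exact: line_sub.
have [s _ [_ _ As]] := dA.
(* As [f x] lies in [D], the quotient [A / (B + K x)] still covers [C / D], although its dimension
   is one less than that of [A / B]. *)
have [|m dm _] := @rdim_exists _ _ A (sadd B (line x)) s lBx.
  by apply: subset_trans As _; apply: span_mod_mono; exact: sadd_subl.
have dA1 := rdim_trans lBx (sadd_subl lx) xA dm (rdim_line lB Bx).
have fBx : f @` sadd B (line x) `<=` D.
  by rewrite image_sadd image_line; apply: sadd_sub => //; exact: line_sub.
have [k dk] := rdim_image_le lD fBx CA dm.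
by rewrite (rdim_uniq lD dk dC) (rdim_uniq lB dA dA1) addn1 ltnn.
Qed.

End InducedOnQuotients.

(** * Trajectories and their growth *)

Section Trajectories.
Context (K : fieldType) (V : lmodType K) (phi : {linear V -> V}).
Implicit Types U W : set V.

(** Starting at [0] makes the index count the summands, as in [traj] (see [trajE]). *)
Definition trajs U n : set V := iter n (fun A => sadd U (phi @` A)) [set 0].

(** For inert [U] this [h] is the limit [H(phi, U)] (see [entropy_atE]); as a natural number it can
    be handled without limits. *)
Definition growth U h :=
  exists m, forall n, (m <= n)%N -> rdim (trajs U n.+1) (trajs U n) h.

(** Finiteness of [(phi U + U) / U], which linear compactness and openness of [U] will provide. It
    makes [T_(n+1) / T_n] finite dimensional for [n > 0]. *)
Definition inert U := exists n, rdim (phi @` U) U n.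

Lemma lin_trajs U n : lin U -> lin (trajs U n).
Proof.
move=> lU; elim: n => [|n IH]; first exact: lin_set0.
by apply: lin_sadd => //; exact: lin_image.
Qed.

Lemma trajsS U n : trajs U n.+1 = sadd U (phi @` trajs U n).
Proof. by []. Qed.

Lemma trajs1 U : trajs U 1 = U.
Proof.
rewrite /trajs /= image_set1 linear0; apply/seteqP; split=> [_ [x Ux [_ -> <-]]|x Ux].
  by rewrite addr0.
by exists x => //; exists 0; rewrite ?addr0.
Qed.

Lemma trajs_mono U U' n : U `<=` U' -> trajs U n `<=` trajs U' n.
Proof.
move=> UU'; elim: n => // n IH; apply: sadd_mono => //; exact: image_subset.
Qed.

Lemma trajs_leS U n : lin U -> trajs U n `<=` trajs U n.+1.
Proof.
move=> lU; elim: n => [|n IH]; first by move=> _ ->; exact: (lin0 (lin_trajs 1 lU)).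
by apply: sadd_mono => //; exact: image_subset.
Qed.

Lemma trajs_le U m n : lin U -> (m <= n)%N -> trajs U m `<=` trajs U n.
Proof.
move=> lU; elim: n => [|n IH]; first by rewrite leqn0 => /eqP ->.
rewrite leq_eqVlt ltnS => /predU1P[->//|/IH mn].
by apply: subset_trans mn _; exact: trajs_leS.
Qed.

Lemma trajs_image U n : lin U -> phi @` trajs U n `<=` trajs U n.+1.
Proof. by move=> lU; exact: sadd_subr. Qed.

Lemma sub_trajs U n : lin U -> U `<=` trajs U n.+1.
Proof. by move=> lU; rewrite -{1}(trajs1 U); exact: trajs_le. Qed.

(** Replacing [U] by one of its trajectories only shifts the index. The successors are there because
    [trajs _ 0] is always [0]. *)
Lemma trajsD U m n : lin U -> trajs (trajs U m.+1) n.+1 = trajs U (m + n).+1.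
Proof.
move=> lU; elim: n => [|n IH]; first by rewrite trajs1 addn0.
have lT k : lin (trajs U k) by exact: lin_trajs.
rewrite trajsS IH addnS [RHS]trajsS; apply/seteqP; split.
  apply: sadd_sub; rewrite -?trajsS//; last exact: trajs_image.
  by apply: trajs_le => //; rewrite ltnS leqW// leq_addr.
by apply: sadd_mono => //; exact: sub_trajs.
Qed.

(** By invariance, [W] absorbs [phi W] at each step. At index [0] the left side would be [0] and the
    right side [W], hence [n.+1]. *)
Lemma trajs_sadd U W n : lin U -> lin W -> phi @` W `<=` W ->
  trajs (sadd U W) n.+1 = sadd (trajs U n.+1) W.
Proof.
move=> lU lW WW; elim: n => [|n IH]; first by rewrite !trajs1.
rewrite trajsS IH image_sadd [trajs U n.+2]trajsS.
rewrite -!saddA; congr sadd.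
rewrite [in LHS]saddC -saddA; congr sadd; apply/seteqP; split.
  by apply: sadd_sub => //; apply: subset_refl.
exact: sadd_subr (lin_image _ lW).
Qed.

Lemma inert_rdim U : lin U -> inert U -> exists n, rdim (trajs U 2) (trajs U 1) n.
Proof.
move=> lU [n dn]; exists n; rewrite trajsS trajs1 saddC.
by apply: (@rdim_sadd _ _ _ _ _ _ lU (@subset_refl _ _) (lin0 lU)).1.
Qed.

(** [phi] induces a surjection from [T_(n+2) / T_(n+1)] onto [T_(n+3) / T_(n+2)]. *)
Lemma rdim_trajsS U n k : lin U -> rdim (trajs U n.+2) (trajs U n.+1) k ->
  exists2 k', rdim (trajs U n.+3) (trajs U n.+2) k' & (k' <= k)%N.
Proof.
move=> lU; apply: rdim_image_le; [exact: lin_trajs|exact: trajs_image|].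
by rewrite [X in X `<=` _]trajsS; apply: sadd_mono => //; exact: sub_trajs.
Qed.

Lemma rdim_trajs_le U m n k : lin U -> (m <= n)%N ->
  rdim (trajs U m.+2) (trajs U m.+1) k ->
  exists2 k', rdim (trajs U n.+2) (trajs U n.+1) k' & (k' <= k)%N.
Proof.
move=> lU + mk; elim: n => [|n IH].
  by rewrite leqn0 => /eqP <-; exists k.
rewrite leq_eqVlt ltnS => /predU1P[<-|/IH[k' dk' k'k]]; first by exists k.
by have [j dj jk'] := rdim_trajsS lU dk'; exists j => //; exact: leq_trans k'k.
Qed.

(** Strong induction on the dimension [k] at index [m]: either it is constant from there on, or it
    is strictly smaller at a later index, where the argument restarts. *)
Lemma growth_exists U : lin U -> inert U -> exists h, growth U h.
Proof.
move=> lU /(inert_rdim lU)[k]; move: (0)%N => m.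
have [n] := ubnP k; elim: n k m => // n IH k m; rewrite ltnS => kn dk.
have [//|] := pselect (exists h, growth U h) => ng.
suff /existsNP[j /not_implyP[mj nj]] : ~ forall j, (m <= j)%N ->
    rdim (trajs U j.+2) (trajs U j.+1) k.
  have [k' dk' k'k] := rdim_trajs_le lU mj dk.
  apply: (IH k' j) => //; apply: leq_trans kn; rewrite ltn_neqAle k'k andbT.
  by apply: contra_notN nj => /eqP <-.
move=> h; apply: ng; exists k, m.+1 => -[|j]// mj; exact: h.
Qed.

(** The generators for [n.+1] are [s] and the images under [phi] of those for [n]. Thus at a fixed
    index the gap between the two trajectories is finite. *)
Lemma trajs_span_mod U U' s n : lin U -> U' `<=` span_mod U s ->
  exists t, trajs U' n `<=` span_mod (trajs U n) t.
Proof.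
move=> lU U's; elim: n => [|n [t nt]]; first by exists [::].
exists (s ++ map phi t); rewrite span_mod_cat trajsS.
have lT := lin_trajs n.+1 lU.
have lt : lin (span_mod (trajs U n.+1) (map phi t)) by exact: lin_span_mod.
apply: sadd_sub; first exact: lin_span_mod.
  apply: subset_trans U's _; apply: span_mod_mono.
  by apply: subset_trans (sub_trajs n lU) _; exact: span_mod_sub.
have : phi @` trajs U' n `<=` span_mod (trajs U n.+1) (map phi t); last first.
  by move/subset_trans; apply; exact: span_mod_sub.
apply: (@image_span_mod_sub _ _ _ phi (trajs U' n) (trajs U n)) => //.
  exact: trajs_image.
exact: sadd_subr.
Qed.

Lemma rdim_trajsD U m n h : lin U ->
  (forall n, (m <= n)%N -> rdim (trajs U n.+1) (trajs U n) h) ->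
  rdim (trajs U (n + m)) (trajs U m) (n * h).
Proof.
move=> lU mh; elim: n => [|n IH].
  by exists [::] => //; split=> //; exact: span_mod_sub.
rewrite mulSn addSn; apply: (@rdim_trans _ _ _ (trajs U (n + m))) => //.
- exact: lin_trajs.
- by apply: trajs_le => //; exact: leq_addl.
- exact: trajs_leS.
- by apply: mh; exact: leq_addl.
Qed.

(** From a common index [p] on, the trajectories of [U] and [U'] gain [h] and [h'] dimensions per
    step, while [T_p(U')] exceeds [T_p(U)] by at most [size t]. Hence [n * h <= n * h' + size t] for
    every [n]. *)
Lemma growth_le U U' k h h' : lin U -> lin U' -> U `<=` U' -> rdim U' U k ->
  growth U h -> growth U' h' -> (h <= h')%N.
Proof.
move=> lU lU' UU' [s _ [_ _ U's]] [m mh] [m' mh'].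
pose p := maxn m m'.
have [t tp] := trajs_span_mod p lU U's.
have bound n : (n * h <= n * h' + size t)%N.
  have [|r <- [rT rf _]] := @rdim_trajsD U p n h lU.
    by move=> j; rewrite geq_max => /andP[+ _]; exact: mh.
  have [|q <- [_ _ qT]] := @rdim_trajsD U' p n h' lU'.
    by move=> j; rewrite geq_max => /andP[_]; exact: mh'.
  rewrite -size_cat; apply: steinitz rf _; first exact: lin_trajs.
  move=> x /rT/(trajs_mono UU')/qT; rewrite span_mod_cat.
  exact: span_mod_mono.
rewrite leqNgt; apply/negP => h'h.
(* If [h' < h], the bound already fails at [n = size t + 1]. *)
have := leq_mul (leqnn (size t).+1) h'h; rewrite mulnS.
move=> /leq_trans/(_ (bound (size t).+1)).
by rewrite addnC leq_add2l ltnn.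
Qed.

Lemma inert_rdim_trajs U n : lin U -> inert U -> exists k, rdim (trajs U n.+1) U k.
Proof.
move=> lU iU; elim: n => [|n [k dk]].
  by exists 0%N; rewrite trajs1; exists [::] => //; split.
have [j dj] := inert_rdim lU iU.
have [i di _] := rdim_trajs_le lU (leq0n n) dj.
exists (i + k)%N; apply: (@rdim_trans _ _ _ (trajs U n.+1)) => //.
- exact: lin_trajs.
- exact: sub_trajs.
- exact: trajs_leS.
Qed.

End Trajectories.

(** * Trajectories under an intertwining map *)

Section TrajectoriesMorphism.
Context (K : fieldType) (X Y : lmodType K) (f : {linear X -> Y}).
Context (psi : {linear X -> X}) (phi : {linear Y -> Y}).
Hypothesis fpsi : forall x, f (psi x) = phi (f x).

Lemma image_trajs (U : set X) n : f @` trajs psi U n = trajs phi (f @` U) n.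
Proof.
elim: n => [|n IH]; first by rewrite /= image_set1 linear0.
rewrite !trajsS image_sadd -IH; congr sadd.
apply/seteqP; split=> _ [_ [x Tx <-] <-].
  by exists (f x); [exists x|rewrite fpsi].
by exists (psi x); [exists x|rewrite fpsi].
Qed.

Lemma growth_image_inj (U : set X) h :
  injective f -> growth psi U h <-> growth phi (f @` U) h.
Proof.
move=> f_inj; have E n :
    rdim (trajs phi (f @` U) n.+1) (trajs phi (f @` U) n) h <->
    rdim (trajs psi U n.+1) (trajs psi U n) h.
  rewrite -!image_trajs rdim_image (_ : _ @^-1` _ = trajs psi U n)//.
  by apply/seteqP; split=> [x [y Ty /f_inj <-]//|x Tx]; exists x.
by split=> -[m mh]; exists m => n mn; apply/E; exact: mh.
Qed.

End TrajectoriesMorphism.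

(** * Additivity of the growth along an invariant subspace *)

Section AdditivityOfGrowth.
Context (K : fieldType) (V : lmodType K).
Implicit Types A B U W : set V.

(** Second isomorphism theorem: combinations of vectors of [A] stay in [A], so they lie in [B]
    exactly when they lie in the intersection. *)
Lemma rdim_setI A B n : lin A -> lin B -> rdim A B n <-> rdim A (B `&` A) n.
Proof.
move=> lA lB; have lBA := lin_setI lB lA.
have sumA s c : (forall x, x \in s -> A x) -> A (\sum_(i < size s) c i *: s`_i).
  by move=> sA; apply: lin_sum => // i; apply: linZ => //; apply/sA/mem_nth.
split=> -[s <- [sA sf As]]; exists s => //; split=> //.
- by apply: free_mod_anti sf; exact: subIsetl.
- move=> x Ax; have /span_modP[c Bc] := As x Ax.
  by apply/span_modP; exists c; split=> //; apply: linB => //; exact: sumA.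
- apply/(free_modP _ lB) => c Bc; apply: (free_modP _ lBA).1 => //.
  by split=> //; exact: sumA.
- by apply: subset_trans As _; apply: span_mod_mono; exact: subIsetl.
Qed.

(** Dimension count in the exact sequence [0 -> (A /\ W) / (B /\ W) -> A / B -> (A + W) / (B + W) ->
    0], by way of [(B + W) /\ A] and the modular law. *)
Lemma rdim_exact A B W p q : lin A -> lin B -> lin W -> B `<=` A ->
  rdim (A `&` W) (B `&` W) p -> rdim (sadd A W) (sadd B W) q ->
  rdim A B (q + p).
Proof.
move=> lA lB lW BA dp dq.
have lAW := lin_setI lA lW; have lBW := lin_sadd lB lW.
have modular : sadd B W `&` A = sadd (A `&` W) B.
  apply/seteqP; split=> [_ [[b Bb [w Ww <-]] Abw]|_ [w [Aw Ww] [b Bb <-]]].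
    exists w; last by exists b => //; rewrite addrC.
    by split=> //; rewrite -[w](addKr b) addrC; apply: linB => //; exact: BA.
  split; last by apply: linD => //; exact: BA.
  by exists b => //; exists w => //; rewrite addrC.
apply: (@rdim_trans _ _ _ (sadd B W `&` A)).
- exact: lin_setI.
- by rewrite modular; exact: sadd_subr.
- exact: subIsetr.
- apply: (@rdim_setI A (sadd B W) q lA lBW).1; apply: (@rdim_sadd _ _ _ _ W q lBW _ (lin0 lW)).2 => //.
  exact: sadd_subr.
- rewrite modular; apply: (@rdim_sadd _ _ _ _ B p lB (@subset_refl _ _) (lin0 lB)).1.
  apply: (@rdim_setI (A `&` W) B p lAW lB).2; rewrite (_ : B `&` _ = B `&` W)//.
  by rewrite setIA (setIidl BA).
Qed.

Variable phi : {linear V -> V}.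
Local Notation trajs := (trajs phi).

(** Write [x = u + phi y] with [y] in [T_(n+2)]; as [x] lies in [W], [phi y] lies in [T_(n+2) + W].
    Equality of the dimensions makes the map induced by [phi] on [(T_(n+2) + W) / (T_(n+1) + W)]
    injective, so [y = t + w] with [t] in [T_(n+1)] and [w] in [W]. Then
    [x = phi w + (u + phi t)]. *)
Lemma trajs_setI U W e m : lin U -> lin W -> phi @` W `<=` W ->
  (forall n, (m <= n)%N -> rdim (trajs (sadd U W) n.+1) (trajs (sadd U W) n) e) ->
  forall n, (m <= n)%N ->
  trajs U n.+3 `&` W `<=`
    sadd (phi @` (trajs U n.+2 `&` W)) (trajs U n.+2 `&` W).
Proof.
move=> lU lW WW de n mn x [[u Uu [_ [y Ty <-] xE]] Wx].
have lUW := lin_sadd lU lW.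
have lT k : lin (trajs (sadd U W) k) by exact: lin_trajs.
have [t Tt [w Ww yE]] : sadd (trajs U n.+1) W y.
  rewrite -trajs_sadd//; move: (de n.+1 (leqW mn)) (de n.+2 (leqW (leqW mn))).
  move=> d1 d2; apply: (@rdim_image_inj _ _ _ phi (trajs (sadd U W) n.+2) _
    (trajs (sadd U W) n.+2) (trajs (sadd U W) n.+3)) d1 d2 _ _ _ => //.
  - exact: trajs_image.
  - by rewrite [X in X `<=` _]trajsS; apply: sadd_mono => //; exact: sub_trajs.
  - exact: trajs_leS.
  - by rewrite trajs_sadd//; exact: sadd_subl.
  - rewrite trajs_sadd// (_ : phi y = - u + x); last by rewrite -xE addKr.
    exists (- u); last by exists x.
    by apply: linN; [exact: lin_trajs|exact: sub_trajs].
have Tw : trajs U n.+2 w.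
  rewrite -[w](addKr t) yE addrC; apply: linB => //; first exact: lin_trajs.
  exact: trajs_leS.
have Wpw : W (phi w) by apply: WW; exists w.
exists (phi w); first by exists w.
exists (u + phi t); last by rewrite -xE -yE linearD addrC addrA.
split; first by exists u => //; exists (phi t) => //; exists t.
have -> : u + phi t = x - phi w; last exact: linB.
by rewrite -xE -yE linearD addrA addrK.
Qed.

(** From a suitable index on, [trajs_setI] makes the traces on [W] satisfy the recursion of a
    trajectory, so [rdim_exact] at one large index relates the three growths. The existence of [h1]
    and [h2] comes later, from the topology. *)
Lemma growth_additive U W h e : lin U -> lin W -> phi @` W `<=` W ->
  growth phi U h -> growth phi (sadd U W) e ->
  exists m, forall h1 h2, growth phi (trajs U m.+1 `&` W) h1 ->
    growth phi (sadd (trajs U m.+1) W) h2 -> h = (h1 + h2)%N.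
Proof.
move=> lU lW WW gU [p pe]; exists p.+1 => h1 h2 g1 g2.
set m := p.+1 in g1 g2.
have lT k : lin (trajs U k) by exact: lin_trajs.
have lTW k : lin (trajs U k `&` W) by exact: lin_setI.
have TW k : trajs (trajs U m.+1 `&` W) k.+1 = trajs U (m + k).+1 `&` W.
  elim: k => [|k IH]; first by rewrite trajs1 addn0.
  rewrite trajsS IH addnS; apply/seteqP; split.
    apply: sadd_sub => //.
      by apply: setSI; apply: trajs_le => //; rewrite ltnS leqW// leq_addr.
    move=> _ [x [Tx Wx] <-]; split; last by apply: WW; exists x.
    by apply: (@trajs_image _ _ _ U) => //; exists x.
  apply: subset_trans (trajs_setI lU lW WW pe (leq_addr k p)) _.
  rewrite -IH -trajsS; apply: sadd_sub; first exact: lin_trajs.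
    exact: trajs_image.
  exact: trajs_leS.
case: gU => q0 g0; case: g1 => q1 g1; case: g2 => q2 g2.
pose k := (q0 + q1 + q2)%N.
have d1 := g1 k.+1 ltac:(rewrite /k; lia).
have d2 := g2 k.+1 ltac:(rewrite /k; lia).
rewrite !TW in d1; rewrite !(trajs_sadd _ (lT _) lW WW) !(trajsD _ _ _ lU) in d2.
have := rdim_exact (lT _) (lT _) lW _ d1 d2.
rewrite addnS => /(_ (@trajs_leS _ _ _ _ _ lU)) d.
rewrite addnC; apply: (rdim_uniq _ _ d); first exact: lT.
by apply: g0; rewrite /k; lia.
Qed.

End AdditivityOfGrowth.

(** * Growth in the quotient space *)

Section QuotientGrowth.
Context (K : fieldType) (V : discreteTvsType K) (W : submodClosed V).
Context (phi : {linear V -> V}) (psi : {linear lquot W -> lquot W}).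
Hypothesis phipsi : forall x, lproj W (phi x) = psi (lproj W x).

(** The preimage in [V] of the image of [T_n] is [T_n + W], which for [n > 0] is the trajectory of
    [U + W]. *)
Lemma growth_lproj (U : set V) h : lin U -> phi @` [set` W] `<=` [set` W] ->
  growth psi (lproj W @` U) h -> growth phi (sadd U [set` W]) h.
Proof.
move=> lU WW [m mh]; exists m.+1 => -[|n]// mn.
rewrite !trajs_sadd//; try exact: lin_submod.
have lW := lin_submod W; have lT := lin_trajs phi n.+1 lU.
apply: (@rdim_sadd _ _ _ _ _ _ (lin_sadd lT lW) (sadd_subr lT) (lin0 lW)).1.
rewrite -preimage_image_lproj; apply/rdim_image.
by rewrite !(image_trajs phipsi); apply: mh; exact: ltnW.
Qed.

End QuotientGrowth.

(** * Entropy at a subspace as its growth *)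

Section EntropyAt.
Context (R : realType) (K : fieldType) (V : discreteTvsType K).
Context (phi : {linear V -> V}) (U : submodClosed V).

Lemma trajE n : [set` traj phi U n] = trajs phi [set` U] n.
Proof.
elim: n => [|n IH].
  apply/seteqP; split=> [x /= /asboolP[u _ ->]|_ ->]; first by rewrite big_ord0.
  exact: rpred0.
rewrite trajsS -IH; apply/seteqP; split=> [x /= /asboolP[u uU ->]|].
  exists (u ord0); first exact: uU.
  exists (phi (\sum_(i < n) iter i phi (u (lift ord0 i)))).
    exists (\sum_(i < n) iter i phi (u (lift ord0 i))) => //=.
    by apply/asboolP; exists (u \o lift ord0) => // i; exact: uU.
  by rewrite big_ord_recl linear_sum.
move=> _ [a aU [_ [_ /asboolP[u uU ->] <-] <-]]; apply/asboolP.
exists (fun i => if unlift ord0 i is Some j then u j else a).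
  by move=> i; case: unliftP => [j _|_]; [exact: uU|exact: aU].
rewrite big_ord_recl unlift_none linear_sum; congr (_ + _).
by apply: eq_bigr => i _; rewrite liftK.
Qed.

Lemma entropy_atE h : inert phi [set` U] -> growth phi [set` U] h ->
  entropy_at phi R U = h%:R%:E.
Proof.
move=> iU [m mh]; have lU := lin_submod U.
have [k dk] := inert_rdim_trajs m lU iU.
have dT n : rdim [set` traj phi U (n + m.+1)] [set` U] (n * h + k).
  rewrite trajE; apply: (@rdim_trans _ _ _ (trajs phi [set` U] m.+1)) => //.
  - exact: lin_trajs.
  - exact: sub_trajs.
  - by apply: trajs_le => //; exact: leq_addl.
  - by apply: rdim_trajsD => // j mj; apply: mh; exact: ltnW.
apply/cvg_lim => //; rewrite -(cvg_shiftn m.+1).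
(* The dimension of [T_(n+m+1) / U] is [n h + k], and [(n h + k) / (n+m+1) = h + c / (n+m+1)]; the
   last reciprocal is [harmonic (n + m)]. *)
pose c : R := k%:R - m.+1%:R * h%:R.
rewrite (_ : [sequence _]_n = EFin \o (fun n => h%:R + c * harmonic (n + m)%N)); last first.
  apply/funext => n; rewrite /= (dim_lquot_sub_in _ (dT n)) -EFinM; congr EFin.
  rewrite /harmonic /= addnS /c.
  have N0 : (n + m).+1%:R != 0 :> R by rewrite pnatr_eq0.
  apply: (mulfI N0); rewrite mulrA divff// mul1r mulrDr mulrCA divff// mulr1.
  rewrite natrD natrM addrCA addrC; congr (_ + _).
  by rewrite -mulrBl -natrB ?ltnS ?leq_addl// -addnS addnK.
apply: (@cvg_EFin _ _ _ _ _ h%:R); first by near=> n.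
have hm : (fun n => harmonic (n + m)%N : R) @ \oo --> (0 : R).
  by rewrite (cvg_shiftn m (harmonic : nat -> R)); exact: cvg_harmonic.
have := cvgD (cvg_cst (h%:R : R) (F := \oo)) (cvgM (cvg_cst c (F := \oo)) hm).
by rewrite mulr0 addr0; exact.
Unshelve. all: by end_near.
Qed.

End EntropyAt.

(** * Linear topologies and linear compactness *)

Section LinearTopology.
Context (K : fieldType) (X : discreteTvsType K).
Implicit Types A B C F L O U : set X.

Lemma addl_continuous (x : X) : continuous (fun y : X => x + y).
Proof.
move=> y; apply: (@continuous_comp _ _ _ (fun z : X => (x, z))
  (fun z : X * X => z.1 + z.2)); last exact: dtvs_add_continuous.
by apply: cvg_pair; [exact: cvg_cst|exact: cvg_id].
Qed.

Lemma open_addl (x : X) A : open A -> open ((fun y : X => x + y) @^-1` A).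
Proof. by move=> oA; apply: open_comp oA => y _; exact: addl_continuous. Qed.

Lemma open_sadd A O : open O -> open (sadd A O).
Proof.
move=> oO; rewrite (_ : sadd A O = \bigcup_(a in A) ((fun y => - a + y) @^-1` O)).
  by apply: bigcup_open => a _; exact: open_addl.
apply/seteqP; split=> [_ [a Aa [y Oy <-]]|x [a Aa Ox]].
  by exists a => //=; rewrite addKr.
by exists a => //; exists (- a + x) => //; rewrite addNKr.
Qed.

Lemma lin_nbhs0_open U : lin U -> nbhs 0 U -> open U.
Proof.
move=> lU; rewrite nbhsE => -[O [oO O0] OU].
rewrite (_ : U = sadd U O); first exact: open_sadd.
apply/seteqP; split; last exact: sadd_sub.
by move=> x Ux; exists x => //; exists 0; rewrite ?addr0.
Qed.

Lemma lin_open_sub U O : lin U -> lin O -> open O -> O `<=` U -> open U.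
Proof.
move=> lU lO oO OU; apply: lin_nbhs0_open => //.
by apply: filterS OU _; apply: open_nbhs_nbhs; split => //; exact: lin0.
Qed.

(** The empty set or a coset of a subspace, phrased without a base point, so that intersections need
    no case distinction. *)
Definition affine A := forall a x y z, A x -> A y -> A z -> A (a *: (y - z) + x).

Lemma lin_affine A : lin A -> affine A.
Proof. by move=> lA a x y z Ax Ay Az; apply: lA.2 => //; exact: linB. Qed.

Lemma affine_setI A B : affine A -> affine B -> affine (A `&` B).
Proof.
move=> aA aB a x y z [Ax Bx] [Ay By] [Az Bz].
by split; [exact: aA|exact: aB].
Qed.

Lemma affine_sadd A B : affine A -> affine B -> affine (sadd A B).
Proof.
move=> aA aB a _ _ _ [x Ax [x' Bx <-]] [y Ay [y' By <-]] [z Az [z' Bz <-]].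
exists (a *: (y - z) + x); first exact: aA.
exists (a *: (y' - z') + x'); first exact: aB.
by rewrite addrACA -scalerDr opprD [y + y' + _]addrACA.
Qed.

(** If [a] is in [A] and [x] is not, the translate [A + (x - a)] is an open neighborhood of [x]
    disjoint from [A]. *)
Lemma affine_closed A : affine A -> open A -> closed A.
Proof.
move=> aA oA; have [[a Aa]|A0] := pselect (A !=set0); last first.
  rewrite (_ : A = set0); first exact: closed0.
  by apply/seteqP; split=> // x Ax; apply: A0; exists x.
rewrite -[A]setCK; apply: open_closedC; rewrite openE => x /= nAx.
apply: (@filterS _ (nbhs x) _ ((fun y => (a - x) + y) @^-1` A)).
  move=> y /= Axy Ay; apply: nAx; have := aA 1 _ _ _ Ay Aa Axy.
  by rewrite scale1r opprD opprB addrA subrK addrC subrK.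
apply: open_nbhs_nbhs; split; first exact: open_addl.
by rewrite /= subrK.
Qed.

Definition linear_base := forall N : set X, nbhs 0 N ->
  exists O, [/\ lin O, open O & O `<=` N].

Definition separated := forall x : X, (forall O, lin O -> open O -> O x) -> x = 0.

Lemma lin_submodE A : lin A -> exists U : submodClosed X, [set` U] = A.
Proof.
move=> lA; pose p : {pred X} := fun x => `[<A x>].
have pc : subsemimod_closed p.
  split; first split=> [|x y /asboolP Ax /asboolP Ay].
  - by apply/asboolP; exact: lin0.
  - by apply/asboolP; exact: linD.
  - by move=> a x /asboolP Ax; apply/asboolP; exact: linZ.
pose U : submodClosed X := HB.pack p (GRing.isSubmodClosed.Build K X p pc).
by exists U; apply/seteqP; split=> x /= /asboolP.
Qed.

Lemma linearly_topologizedP :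
  linearly_topologized X <-> linear_base /\ separated.
Proof.
split=> [[hX bX]|[bX sX]].
  have bX' : linear_base.
    move=> N /bX[W nW WN]; exists [set` W]; split => //.
      exact: lin_submod.
    by apply: lin_nbhs0_open nW; exact: lin_submod.
  split=> // x xO; apply: hX => P Q nP nQ.
  have [O [lO oO OQ]] := bX' _ nQ.
  by exists x; split; [exact: nbhs_singleton nP|apply: OQ; exact: xO].
split=> [p q cpq|N /bX[O [lO oO ON]]].
  apply/eqP; rewrite -subr_eq0; apply/eqP; apply: sX => O lO oO.
  have nO (x : X) : nbhs x ((fun y => - x + y) @^-1` O).
    apply: open_nbhs_nbhs; split; first exact: open_addl.
    by rewrite /= addNr; exact: lin0.
  have [y [/= yp yq]] := cpq _ _ (nO p) (nO q).
  rewrite (_ : p - q = (- q + y) - (- p + y)); first exact: linB.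
  by rewrite opprD opprK addrACA subrr addr0 addrC.
have [U UE] := lin_submodE lO; exists U; rewrite UE//.
by apply: open_nbhs_nbhs; split => //; exact: lin0.
Qed.

(** If [x] were outside [C], some [x + O] would avoid [C], against [x] being in [C + O]. *)
Lemma closed_sadd_open C x : linear_base -> closed C ->
  (forall O, lin O -> open O -> sadd C O x) -> C x.
Proof.
move=> bX cC xCO; apply: contrapT => nCx.
have : nbhs 0 ((fun y => x + y) @^-1` (~` C)).
  apply: open_nbhs_nbhs; split; first by apply: open_addl; exact: closed_openC.
  by rewrite /= addr0.
move=> /bX[O [lO oO OC]]; have [c Cc [o Oo cox]] := xCO O lO oO.
by apply: (OC (- o)); [exact: linN|rewrite /= -cox addrK].
Qed.

Definition directed (F : set (set X)) :=
  F !=set0 /\ forall A B, F A -> F B -> exists2 C, F C & C `<=` A `&` B.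

(* For linear subspaces this is linear compactness (see [linearly_compactP]);
   open affine sets suffice since a closed one is an intersection of open
   ones, and directedness replaces the finite intersection property. *)
Definition lin_compact L := forall F : set (set X), directed F ->
  (forall A, F A -> [/\ open A, affine A & (A `&` L) !=set0]) ->
  exists2 x, L x & forall A, F A -> A x.

(** Each closed [A] is replaced by the open sets [A + O], whose intersection is [A]. *)
Lemma lin_compact_closed L : linear_base -> lin_compact L ->
  forall F : set (set X), directed F ->
  (forall A, F A -> [/\ closed A, affine A & (A `&` L) !=set0]) ->
  exists2 x, L x & forall A, F A -> A x.
Proof.
move=> bX cL F [[A0 FA0] dF] FL.
pose F' := [set B | exists A O, [/\ F A, lin O, open O & B = sadd A O]].
have [||x Lx xF] := cL F'.
- split; first by exists (sadd A0 setT), A0, setT; split=> //; exact: openT.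
  move=> _ _ [A [O [FA lO oO ->]]] [B [P [FB lP oP ->]]].
  have [C FC CAB] := dF _ _ FA FB; exists (sadd C (O `&` P)).
    by exists C, (O `&` P); split=> //; [exact: lin_setI|exact: openI].
  by move=> x Cx; split; move: x Cx; apply: sadd_mono => [y /CAB[]|y []].
- move=> _ [A [O [FA lO oO ->]]]; have [cA aA [x [Ax Lx]]] := FL A FA.
  split; [exact: open_sadd|by apply: affine_sadd => //; exact: lin_affine|].
  by exists x; split=> //; exact: sadd_subl.
exists x => // A FA; have [cA _ _] := FL A FA.
apply: closed_sadd_open => // O lO oO; apply: xF.
by exists A, O.
Qed.

Lemma lin_compact_setI L C : linear_base -> lin_compact L -> closed C ->
  affine C -> lin_compact (L `&` C).
Proof.
move=> bX cL cC aC F [[A0 FA0] dF] FL.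
have [||x Lx xF] := lin_compact_closed bX cL (F := [set A `&` C | A in F]).
- split; first by exists (A0 `&` C), A0.
  move=> _ _ [A FA <-] [B FB <-]; have [D FD DAB] := dF _ _ FA FB.
  exists (D `&` C); first by exists D.
  by move=> x [/DAB[Ax Bx] Cx].
- move=> _ [A FA <-]; have [oA aA [x [Ax [Lx Cx]]]] := FL A FA.
  split; [apply: closedI => //; exact: affine_closed|exact: affine_setI|].
  by exists x.
exists x; last by move=> A FA; case: (xF (A `&` C)) => //; exists A.
by split=> //; case: (xF (A0 `&` C)) => //; exists A0.
Qed.

(** Either every member contains the line, or some [A] meets it in a single point [p]; then [p] is
    in each [B], since a member inside both [A] and [B] meets the line too. *)
Lemma lin_compact_line (x : X) : lin_compact (line x).
Proof.
move=> F [[A0 FA0] dF] FL.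
have [xA|/existsNP[A /not_implyP[FA nA]]] :=
  pselect (forall A, F A -> line x `<=` A).
  exists 0; first exact: lin0 (lin_line x).
  by move=> A /xA; apply; exact: lin0 (lin_line x).
have [_ aA [p [Ap [b _ bp]]]] := FL A FA; exists p; first by exists b.
move=> B FB; have [C FC CAB] := dF _ _ FA FB.
have [_ _ [q [Cq [c _ cq]]]] := FL C FC; have [Aq Bq] := CAB _ Cq.
suff -> : p = q by [].
(* Two distinct points of the line in [A] would put the whole line in [A]. *)
rewrite -bp -cq; apply: contrapT => /eqP; rewrite -subr_eq0 -scalerBl => pq.
have bc : b - c != 0 by apply: contraNneq pq => ->; rewrite scale0r.
apply: nA => _ [a _ <-].
have := aA ((a - b) / (b - c)) p p q Ap Ap Aq.
rewrite -bp -cq -scalerBl scalerA divfK// -scalerDl subrK; exact.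
Qed.

(** Compactness of [M] gives [y] in [M] lying in every [A + L]; compactness of [L], applied to the
    translates [A - y], then gives [x] in [L] with [x + y] in every [A]. *)
Lemma lin_compact_sadd L M :
  lin L -> lin_compact L -> lin_compact M -> lin_compact (sadd L M).
Proof.
move=> lL cL cM F [[A0 FA0] dF] FL.
have [||y My yF] := cM [set sadd A L | A in F].
- split; first by exists (sadd A0 L), A0.
  move=> _ _ [A FA <-] [B FB <-]; have [D FD DAB] := dF _ _ FA FB.
  exists (sadd D L); first by exists D.
  by move=> x Dx; split; move: x Dx; apply: sadd_mono => // z /DAB[].
- move=> _ [A FA <-]; have [oA aA [x [Ax [l Ll [m Mm lm]]]]] := FL A FA.
  split; [by rewrite saddC; exact: open_sadd|by apply: affine_sadd => //; exact: lin_affine|].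
  exists m; split=> //; exists x => //; exists (- l); first exact: linN.
  by rewrite -lm addrC addKr.
have [||x Lx xF] := cL [set (fun z => y + z) @^-1` A | A in F].
- split; first by exists ((fun z => y + z) @^-1` A0), A0.
  move=> _ _ [A FA <-] [B FB <-]; have [D FD DAB] := dF _ _ FA FB.
  exists ((fun z => y + z) @^-1` D); first by exists D.
  by move=> x /DAB.
- move=> _ [A FA <-]; have [oA aA _] := FL A FA; split; first exact: open_addl.
    move=> a u v w Au Av Aw /=; have := aA a _ _ _ Au Av Aw.
    by rewrite opprD addrACA subrr add0r addrCA.
  have [a Aa [l Ll al]] := yF (sadd A L) (ex_intro2 _ _ A FA erefl).
  by exists (- l); split; [rewrite /= -al addrK|exact: linN].
exists (x + y); first by exists x => //; exists y.
by move=> A FA; rewrite addrC; apply: (xF (_ @^-1` A)); exists A.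
Qed.

Lemma lin_compact_span_mod L s :
  lin L -> lin_compact L -> lin_compact (span_mod L s).
Proof.
move=> lL cL; elim: s => //= x s IH; apply: lin_compact_sadd => //.
- exact: lin_span_mod.
- exact: lin_compact_line.
Qed.

Lemma linear_varietyP A : closed_linear_variety A <->
  [/\ closed A, affine A & A !=set0].
Proof.
have transl (v : X) (B : set X) : [set v + w | w in B] = (fun y => - v + y) @^-1` B.
  apply/seteqP; split=> [_ [w Bw <-]|x Bx]; first by rewrite /= addKr.
  by exists (- v + x) => //; rewrite addNKr.
have closed_transl (v : X) (B : set X) : closed B -> closed ((fun y => v + y) @^-1` B).
  by move=> cB; apply: preimage_closed cB => y _; exact: addl_continuous.
split=> [[v [W [cW ->]]]|[cA aA [v Av]]].
  split.
  - by rewrite transl; exact: closed_transl.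
  - move=> a _ _ _ [x Wx <-] [y Wy <-] [z Wz <-]; exists (a *: (y - z) + x).
      by apply: (lin_affine (lin_submod W)).
    by rewrite opprD addrACA subrr add0r addrCA.
  - by exists v, 0; rewrite ?addr0//=; exact: rpred0.
have lW : lin ((fun y => v + y) @^-1` A).
  split=> [|a x y Ax Ay] /=; first by rewrite addr0.
  have := aA a _ _ _ Ay Ax Av; rewrite [v + x]addrC addrK addrCA; exact.
have [W WE] := lin_submodE lW; exists v, W; rewrite WE; split; first exact: closed_transl.
rewrite transl; apply/seteqP; split=> x /=; by rewrite addNKr.
Qed.

(** A directed family of nonempty sets has the finite intersection property; conversely, the finite
    intersections of members of [F] form a directed family. *)
Lemma linearly_compactP : linearly_topologized X ->
  linearly_compact X <-> lin_compact setT.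
Proof.
move=> tX; have [bX _] := linearly_topologizedP.1 tX.
split=> [[_ cX] F [[A0 FA0] dF] FX|cX].
  have [|D DF|x xF] := cX F.
  - move=> A FA; have [oA aA [x [Ax _]]] := FX A FA.
    by apply/linear_varietyP; split; [exact: affine_closed| |exists x].
  - suff [B FB BD] : exists2 B, F B & forall A, A \in D -> B `<=` A.
      have [_ _ [x [Bx _]]] := FX B FB; exists x => A /= AD.
      exact: BD Bx.
    have {DF} : forall A, A \in (D : seq _) -> F A by move=> A /DF; rewrite inE.
    suff : forall s : seq (set X), (forall A, A \in s -> F A) ->
        exists2 B, F B & forall A, A \in s -> B `<=` A by apply.
    elim=> [|A s IH] sF; first by exists A0.
    have [|B FB Bs] := IH; first by move=> C Cs; apply: sF; rewrite in_cons Cs orbT.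
    have [|C FC CAB] := dF A B _ FB; first by apply: sF; rewrite mem_head.
    exists C => // E; rewrite in_cons => /predU1P[->|/Bs BE] x /CAB[]// _.
    exact: BE.
  by exists x.
split=> // F FX fF.
pose F' := [set \bigcap_(A in [set` D]) A | D in [set D : {fset set X} | {subset D <= F}]].
have [||x _ xF] := lin_compact_closed bX cX (F := F').
- split; first by exists (\bigcap_(A in [set` fset0]) A), fset0.
  move=> _ _ [D DF <-] [E EF <-].
  exists (\bigcap_(A in [set` (D `|` E)%fset]) A).
    by exists (D `|` E)%fset => // A; rewrite inE => /orP[/DF|/EF].
  by move=> x DE; split=> A /= AD; apply: DE; rewrite /= inE AD ?orbT.
- move=> _ [D DF <-]; have DX A : [set` D] A -> closed A /\ affine A.
    by move=> /DF; rewrite inE => /FX/linear_varietyP[].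
  split.
  + by apply: closed_bigI => A /DX[].
  + move=> a x y z Dx Dy Dz A DA; apply: (DX A DA).2; [exact: Dx|exact: Dy|exact: Dz].
  + by have [x Dx] := fF D DF; exists x.
exists x => A FA; apply: (xF (\bigcap_(B in [set` [fset A]%fset]) B)) => /=; last by rewrite inE.
by exists [fset A]%fset => // B; rewrite inE => /eqP ->; rewrite inE.
Qed.

End LinearTopology.

(** * Linearly compact subspaces modulo open ones *)

Section Commensurability.
Context (K : fieldType) (X : discreteTvsType K) (L O : set X).
Hypotheses (lL : lin L) (lO : lin O).

(** Exchange: [free_mod] separates [x] from the entries after it only. If an earlier entry [z]
    occurred with nonzero coefficient in an expression of [x], solving for [z] would contradict its
    own independence. *)
Lemma free_mod_middle (s t : seq X) x :
  free_mod O (t ++ x :: s) -> ~ span_mod (span_mod O s) t x.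
Proof.
elim: t => [|z t IH] /=; first by case.
move=> [fts nz] [u su [_ [a _ <-] xE]].
have [a0|a0] := eqVneq a 0.
  by apply: (IH fts); rewrite -xE a0 scale0r addr0.
apply: nz; have -> : z = a^-1 *: (x - u).
  by rewrite -xE addrC addKr scalerA mulVf// scale1r.
have lts := lin_span_mod (t ++ x :: s) lO.
apply: linZ => //; apply: linB => //.
  by apply: span_mod_mem => //; rewrite mem_cat mem_head orbT.
rewrite span_mod_cat; apply: span_mod_mono su; apply: sadd_subl.
exact: lin_line.
Qed.

(* Were [(L + O) / O] infinite dimensional, the affine sets
   [x_0 + ... + x_(n-1) + span(x_i | i >= n) + O], for a sequence [x] of
   elements of [L] that is independent modulo [O], would have no common
   point. *)
Lemma lin_compact_rdim : open O -> lin_compact L -> exists n, rdim L O n.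
Proof.
move=> oO cL; apply: contrapT => nd.
(* [g s] extends a free family [s] of vectors of [L]; for any other [s] the value is [0]. *)
have /choice[g gP] : forall s, exists x,
    (forall y, y \in s -> L y) -> free_mod O s -> L x /\ ~ span_mod O s x.
  move=> s; have [[sL sf]|ns] := pselect ((forall y, y \in s -> L y) /\ free_mod O s).
    by have [x xP] := free_mod_extend lO sL sf nd; exists x.
  by exists 0 => ? ?; exfalso; apply: ns.
(* [S n] lists [x_(n-1), ..., x_0], and [sq n k] below lists [x_(n+k-1), ..., x_n]. *)
pose S n := iter n (fun s => g s :: s) [::].
pose x n := g (S n).
have SP n : (forall y, y \in S n -> L y) /\ free_mod O (S n).
  elim: n => // n [SL Sf]; have [Lg ng] := gP _ SL Sf; split=> // y.
  by rewrite in_cons => /predU1P[->//|/SL].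
have Lx n : L (x n) by have [SL Sf] := SP n; have [] := gP _ SL Sf.
pose sq n k := iteri k (fun i s => x (n + i)%N :: s) [::].
have sqS n k : sq n k.+1 = x (n + k)%N :: sq n k by [].
have SE n k : S (n + k)%N = sq n k ++ S n.
  by elim: k => [|k IH]; rewrite ?addn0// addnS /= -IH.
(* [M n] is [O + span(x_i | i >= n)], an increasing union over [k]; below, [A n] is its translate by
   [p n]. *)
pose M n := [set y | exists k, span_mod O (sq n k) y].
have sqle n k j : span_mod O (sq n k) `<=` span_mod O (sq n (k + j)%N).
  elim: j => [|j IH]; first by rewrite addn0.
  rewrite addnS; apply: subset_trans IH _ => /=.
  by apply: sadd_subl; exact: lin_line.
have lM n : lin (M n).
  split=> [|a y z [k yk] [j zj]]; first by exists 0%N; exact: lin0.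
  exists (k + j)%N; apply: (lin_span_mod _ lO).2; first exact: sqle yk.
  by rewrite addnC; exact: sqle zj.
have OM n : O `<=` M n by move=> y Oy; exists 0%N.
have Mx n : M n (x n).
  exists 1%N; apply: sadd_subr => //; rewrite /= addn0; exact: line_id.
have MS n : M n.+1 `<=` M n.
  move=> y [k yk]; exists k.+1; apply: span_mod_least yk.
  - exact: lin_span_mod.
  - exact: span_mod_sub.
  - elim: k {y} => // k IH y.
    rewrite sqS in_cons addSnnS [sq n k.+2]sqS => /predU1P[->|/IH yk].
      apply: (@sadd_subr _ _ (span_mod O (sq n k.+1))); last exact: line_id.
      exact: lin_span_mod.
    by apply: sadd_subl yk; exact: lin_line.
pose p n := \sum_(i < n) x i.
have Lp n : L (p n) by apply: lin_sum.
pose A n := (fun y => - p n + y) @^-1` M n.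
have AS n : A n.+1 `<=` A n.
  move=> y Ay; rewrite /A /= (_ : - p n + y = x n + (- p n.+1 + y)).
    by apply: linD => //; exact: MS.
  by rewrite /p big_ord_recr /= opprD (addrC _ (- x n)) -addrA addNKr.
have Ale n k : A (n + k)%N `<=` A n.
  elim: k => [|k IH]; first by rewrite addn0.
  by rewrite addnS; apply: subset_trans IH; exact: AS.
have [||y Ly yA] := cL [set A n | n in setT].
- split; first by exists (A 0%N), 0%N.
  move=> _ _ [n _ <-] [m _ <-]; exists (A (n + m)%N); first by exists (n + m)%N.
  by move=> z Az; split; [exact: Ale Az|apply: (@Ale m n); rewrite addnC].
- move=> _ [n _ <-]; split.
  + by apply: open_addl; apply: lin_open_sub (OM n).
  + move=> a u v w Au Av Aw; have := lin_affine (lM n) a Au Av Aw.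
    by rewrite /A /= opprD addrACA subrr add0r addrCA.
  + by exists (p n); split=> //; rewrite /A /= addNr; exact: lin0.
(* The common point [y] lies in [M 0], hence in [O + span(x_i | i < k)] for some [k]. Its membership
   in [A k.+1] then expresses [x_k] through [O] and the other [x_i]. *)
have [k] : A 0%N y by apply: yA; exists 0%N.
rewrite /p big_ord0 oppr0 add0r => yk.
have [j yj] : A k.+1 y by apply: yA; exists k.+1.
have [_] := SP (k.+1 + j)%N; rewrite SE => /free_mod_middle; apply.
have S0 : S k = sq 0 k by rewrite -[k]add0n SE cats0.
have lspan : lin (span_mod (span_mod O (S k)) (sq k.+1 j)).
  by apply: lin_span_mod; exact: lin_span_mod.
have pk : span_mod O (S k) (p k).
  apply: lin_sum; first exact: lin_span_mod.
  move=> i; apply: span_mod_mem => //.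
  have xS n l : (n < l)%N -> x n \in S l.
    by move=> nl; rewrite -(subnKC nl) SE mem_cat mem_head orbT.
  exact: xS.
rewrite -/(x k) (_ : x k = (y - p k) - (- p k.+1 + y)).
  apply: linB => //; last by apply: span_mod_mono yj; exact: span_mod_sub.
  apply: (@span_mod_sub _ _ (span_mod O (S k))).
  by apply: linB => //; [exact: lin_span_mod|rewrite S0].
by rewrite /p big_ord_recr /= !opprD !opprK -!addrA addKr addrC subrK.
Qed.

End Commensurability.

(** * Continuous images, subspaces and quotients *)

Section ContinuousMaps.
Context (K : fieldType) (X Y : discreteTvsType K) (f : {linear X -> Y}).
Hypothesis cf : continuous f.

Lemma lin_compact_image (L : set X) : lin_compact L -> lin_compact (f @` L).
Proof.
move=> cL F [[A0 FA0] dF] FL.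
have [||x Lx xF] := cL [set f @^-1` A | A in F].
- split; first by exists (f @^-1` A0), A0.
  move=> _ _ [A FA <-] [B FB <-]; have [D FD DAB] := dF _ _ FA FB.
  by exists (f @^-1` D); [exists D|move=> x /DAB].
- move=> _ [A FA <-]; have [oA aA [y [Ay [x Lx xE]]]] := FL A FA; split.
  + by apply: open_comp oA => x' _; exact: cf.
  + by move=> a u v w Au Av Aw /=; rewrite linearP linearB; exact: aA.
  + by exists x; split=> //; rewrite /= xE.
exists (f x); first by exists x.
by move=> A FA; apply: (xF (f @^-1` A)); exists A.
Qed.

End ContinuousMaps.

Section SubspaceTopology.
Context (K : fieldType) (V : discreteTvsType K) (W : submodClosed V).
Hypothesis tV : linearly_topologized V.
Local Notation linc := (@linc K V W).

Lemma linc_continuous : continuous linc.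
Proof. exact: lsub_val_continuous. Qed.

Lemma open_lincP (A : set (lsub W)) :
  open A <-> exists2 B : set V, open B & linc @^-1` B = A.
Proof. by []. Qed.

Lemma linearly_topologized_lsub : linearly_topologized (lsub W).
Proof.
have [bX sX] := (linearly_topologizedP V).1 tV.
apply/linearly_topologizedP; split.
  move=> N; rewrite nbhsE => -[_ [/open_lincP[B oB <-] B0] BN].
  have [|O [lO oO OB]] := bX B; first by apply: open_nbhs_nbhs.
  exists (linc @^-1` O); split; first exact: lin_preimage.
    by apply/open_lincP; exists O.
  by move=> x /OB Bx; exact: BN.
move=> x xO; apply: (@linc_inj _ _ W); apply: sX => O lO oO.
apply: (xO (linc @^-1` O)); first exact: lin_preimage.
by apply/open_lincP; exists O.
Qed.

(** An open affine subset of [lsub W] is closed there, hence closed in [V] because [W] is, so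
    [lin_compact_closed] applies to the images in [V]. *)
Lemma lin_compact_linc (S : set (lsub W)) : closed [set` W] ->
  lin_compact (linc @` S) -> lin_compact S.
Proof.
move=> cW cS F [[A0 FA0] dF] FS.
have [bX _] := (linearly_topologizedP V).1 tV.
have [||_ [x Sx <-] xF] := lin_compact_closed bX cS (F := [set linc @` A | A in F]).
- split; first by exists (linc @` A0), A0.
  move=> _ _ [A FA <-] [B FB <-]; have [D FD DAB] := dF _ _ FA FB.
  exists (linc @` D); first by exists D.
  by move=> _ [x /DAB[Ax Bx] <-]; split; exists x.
- move=> _ [A FA <-]; have [oA aA [x [Ax Sx]]] := FS A FA; split.
  + have /closed_openC/open_lincP[B oB BA] := affine_closed aA oA.
    rewrite (_ : linc @` A = ~` B `&` [set` W]).
      by apply: closedI => //; exact: open_closedC.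
    apply/seteqP; split=> [_ [y Ay <-]|y [nBy yW]].
      split; last exact: valP.
      by move=> By; have : (~` A) y by rewrite -BA.
    exists (Sub y yW) => //; apply: contrapT => nA.
    by apply: nBy; have : (~` A) (Sub y yW) by []; rewrite -BA.
  + move=> a _ _ _ [u Au <-] [v Av <-] [w Aw <-].
    by exists (a *: (v - w) + u); [exact: aA|rewrite linearP linearB].
  + by exists (linc x); split; exists x.
exists x => // A FA; have [|z Az /linc_inj <-//] := xF (linc @` A).
by exists A.
Qed.

End SubspaceTopology.

Lemma lc_openP (K : fieldType) (V : discreteTvsType K) (U : submodClosed V) :
  linearly_topologized V ->
  lc_open V U <-> open [set` U] /\ lin_compact [set` U].
Proof.
move=> tV; have tU := linearly_topologized_lsub U tV.
rewrite -[in X in _ <-> X](image_linc_setT U); split=> -[oU].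
  move=> /(linearly_compactP tU) cU; rewrite image_linc_setT; split=> //.
  rewrite -image_linc_setT; apply: lin_compact_image cU.
  exact: linc_continuous.
rewrite image_linc_setT in oU => cU; split=> //; apply/linearly_compactP => //.
apply: (lin_compact_linc tV) cU; apply: affine_closed => //.
by apply: lin_affine; exact: lin_submod.
Qed.

Lemma linearly_topologized_lquot (K : fieldType) (V : discreteTvsType K)
    (W : submodClosed V) :
  linearly_topologized V -> closed [set` W] -> linearly_topologized (lquot W).
Proof.
move=> /linearly_topologizedP[bV sV] cW; apply/linearly_topologizedP; split.
  move=> N nN; have : nbhs 0 (lproj W @^-1` N).
    by apply: lproj_continuous; rewrite linear0.
  move=> /bV[O [lO oO ON]]; exists (lproj W @` O); split.
  - exact: lin_image.
  - exact: lproj_open.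
  - by move=> _ [x /ON Nx <-].
move=> u; have [x <-] := lproj_surj u => xO; apply/lproj_eq0.
suff : [set` W] x by [].
(* Being closed, [W] is the intersection of the subspaces [W + O]. *)
apply: closed_sadd_open => // O lO oO; rewrite saddC -preimage_image_lproj.
by apply: xO; [exact: lin_image|exact: lproj_open].
Qed.

(** * Entropy at a linearly compact open subspace *)

Section EntropyOfCompactOpen.
Context (R : realType) (K : fieldType) (V : discreteTvsType K).
Context (phi : {linear V -> V}).
Hypotheses (tV : linearly_topologized V) (cphi : continuous phi).

Lemma entropy_at_growth U : lc_open V U ->
  exists2 h, growth phi [set` U] h & entropy_at phi R U = h%:R%:E.
Proof.
move=> /(lc_openP _ tV)[oU cU]; have lU := lin_submod U.
have iU : inert phi [set` U].
  apply: lin_compact_rdim => //; first exact: lin_image.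
  exact: lin_compact_image.
have [h gh] := growth_exists lU iU; exists h => //.
exact: entropy_atE.
Qed.

(** A trajectory is open because it contains [U], and linearly compact as a finite sum of continuous
    images of [U]. *)
Lemma lc_open_trajs U n : lc_open V U ->
  exists2 U', lc_open V U' & [set` U'] = trajs phi [set` U] n.+1.
Proof.
move=> /(lc_openP _ tV)[oU cU]; have lU := lin_submod U.
have [U' UE] := lin_submodE (lin_trajs phi n.+1 lU).
exists U' => //; apply/lc_openP => //; rewrite UE; split.
  by apply: lin_open_sub (sub_trajs _ _ lU) => //; exact: lin_trajs.
elim: n {U' UE} => [|n IH]; first by rewrite trajs1.
rewrite trajsS; apply: lin_compact_sadd => //.
exact: lin_compact_image.
Qed.

End EntropyOfCompactOpen.

(** * Additivity at one subspace, cofinality and passage to suprema *)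

Section AdditionTheorem.
Context (R : realType) (K : fieldType) (V : discreteTvsType K).
Context (phi : {linear V -> V}) (W : submodClosed V).
Hypotheses (llcV : locally_linearly_compact V) (cphi : continuous phi).
Hypotheses (clW : closed [set` W]) (phiW : {in W, forall x, phi x \in W}).

Let tV : linearly_topologized V := llcV.1.
Let tW : linearly_topologized (lsub W) := linearly_topologized_lsub W tV.
Let tQ : linearly_topologized (lquot W) := linearly_topologized_lquot tV clW.

Lemma lc_open_sub_in U : lc_open V U -> lc_open (lsub W) (sub_in W U).
Proof.
have [bV _] := (linearly_topologizedP V).1 tV.
move=> /(lc_openP _ tV)[oU cU]; apply/lc_openP => //; split.
  by apply/open_lincP; exists [set` U].
apply: (lin_compact_linc tV) => //; rewrite image_linc_sub_in.
by apply: lin_compact_setI => //; apply: lin_affine; exact: lin_submod.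
Qed.

Lemma lc_open_lproj U : lc_open V U ->
  exists2 Q, lc_open (lquot W) Q & [set` Q] = lproj W @` [set` U].
Proof.
move=> /(lc_openP _ tV)[oU cU].
have [Q QE] := lin_submodE (lin_image (lproj W) (lin_submod U)).
exists Q => //; apply/lc_openP => //; rewrite QE; split; first exact: lproj_open.
by apply: lin_compact_image cU; exact: lproj_continuous.
Qed.

(** [U'] is a trajectory of [U] long enough for [growth_additive]; that it contains [U] serves the
    cofinality argument. *)
Lemma entropy_at_additive U : lc_open V U ->
  exists (U' : submodClosed V) (Q : submodClosed (lquot W)), [/\ [set` U] `<=` [set` U'], lc_open V U', lc_open (lquot W) Q,
    [set` Q] = lproj W @` [set` U'] &
    entropy_at phi R U = (entropy_at (restr phiW) R (sub_in W U') +
                          entropy_at (induced phiW) R Q)%E].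
Proof.
move=> lcU; have lU := lin_submod U; have lW := lin_submod W.
have WW : phi @` [set` W] `<=` [set` W] by move=> _ [x xW <-]; exact: phiW.
have [h gh ->] := entropy_at_growth R tV cphi lcU.
have [Q0 lcQ0 Q0E] := lc_open_lproj lcU.
have cind := @induced_continuous _ _ _ _ phiW cphi.
have phipi x : lproj W (phi x) = induced phiW (lproj W x).
  by rewrite /lproj induced_pi.
(* The growth [e] of the image of [U] in [V / W] shows that the dimensions of the quotients of
   successive [T_n + W] become stationary. *)
have [e ge _] := entropy_at_growth R tQ cind lcQ0.
rewrite Q0E in ge; have {}ge := growth_lproj phipi lU WW ge.
have [m hm] := growth_additive lU lW WW gh ge.
have [U' lcU' UE] := lc_open_trajs tV cphi m lcU.
have [Q lcQ QE] := lc_open_lproj lcU'.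
exists U', Q; split => //; first by rewrite UE; exact: sub_trajs.
have cres := @restr_continuous _ _ _ _ phiW cphi.
have [h1 g1 ->] := entropy_at_growth R tW cres (lc_open_sub_in lcU').
have [h2 g2 ->] := entropy_at_growth R tQ cind lcQ.
rewrite -EFinD -natrD; congr (_%:R%:E); apply: hm; rewrite -UE.
  rewrite -image_linc_sub_in.
  by apply/(@growth_image_inj _ _ _ _ (restr phiW)) => //; exact: linc_inj.
by apply: (growth_lproj phipi (lin_submod _) WW); rewrite -QE.
Qed.

(** [U'] is linearly compact and [U] is open, so [U' / U] is finite dimensional and [growth_le]
    applies. *)
Lemma entropy_at_le (X : discreteTvsType K) (psi : {linear X -> X}) U U' :
  linearly_topologized X -> continuous psi -> lc_open X U -> lc_open X U' ->
  [set` U] `<=` [set` U'] -> (entropy_at psi R U <= entropy_at psi R U')%E.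
Proof.
move=> tX cpsi lcU lcU' UU'.
have [h gh ->] := entropy_at_growth R tX cpsi lcU.
have [h' gh' ->] := entropy_at_growth R tX cpsi lcU'.
have [oU _] := (lc_openP U tX).1 lcU.
have [_ cU'] := (lc_openP U' tX).1 lcU'.
have lU := lin_submod U; have lU' := lin_submod U'.
have [k dk] := lin_compact_rdim lU' lU oU cU'.
by rewrite lee_fin ler_nat (growth_le lU lU' UU' dk gh gh').
Qed.

(** To any [U0] in B(V) one adds [U1] and lifts of a finite family generating [U2] modulo the image
    of [U0]. *)
Lemma lc_open_cofinal U1 U2 : lc_open (lsub W) U1 -> lc_open (lquot W) U2 ->
  exists U : submodClosed V, [/\ lc_open V U, [set` U1] `<=` [set` sub_in W U] &
    [set` U2] `<=` lproj W @` [set` U]].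
Proof.
move=> /(lc_openP _ tW)[_ cU1] /(lc_openP _ tQ)[_ cU2].
have [U0 lcU0] := llcV.2; have [oU0 cU0] := (lc_openP U0 tV).1 lcU0.
have lU0 := lin_submod U0.
have [n [t _ [_ _ U2t]]] : exists n, rdim [set` U2] (lproj W @` [set` U0]) n.
  apply: lin_compact_rdim => //; [exact: lin_submod|exact: lin_image|].
  exact: lproj_open.
have [s st] : exists s, map (lproj W) s = t.
  elim: t {U2t} => [|u t [s <-]]; first by exists [::].
  by have [x <-] := lproj_surj u; exists (x :: s).
pose L := span_mod (sadd [set` U0] (@linc _ _ W @` [set` U1])) s.
have lU1 : lin (@linc _ _ W @` [set` U1]) by apply: lin_image; exact: lin_submod.
have lU01 := lin_sadd lU0 lU1.
have lL : lin L by exact: lin_span_mod.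
have U0L : [set` U0] `<=` L.
  by apply: subset_trans (sadd_subl lU1) _; exact: span_mod_sub.
have [U UE] := lin_submodE lL; exists U; split.
- apply/lc_openP => //; rewrite UE; split; first exact: lin_open_sub U0L.
  apply: lin_compact_span_mod => //; apply: lin_compact_sadd => //.
  by apply: lin_compact_image cU1; exact: linc_continuous.
- move=> x U1x; suff : [set` U] (linc x) by [].
  rewrite UE; apply: span_mod_sub; apply: sadd_subr => //; by exists x.
- rewrite UE; apply: subset_trans U2t _; apply: span_mod_least.
  + exact: lin_image.
  + exact: image_subset.
  + move=> u; rewrite -st => /mapP[x xs ->]; exists x => //.
    exact: span_mod_mem.
Qed.

End AdditionTheorem.

Theorem theorem6p3 (R : realType) (K : fieldType) (V : discreteTvsType K)
    (phi : {linear V -> V}) (W : submodClosed V)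
    (llcV : locally_linearly_compact V)
    (cphi : continuous phi)
    (clW : closed [set` W])
    (phiW : {in W, forall x, phi x \in W}) :
  ent phi R = (ent (restr phiW) R + ent (induced phiW) R)%E.
Proof.
have tV := llcV.1; have tW := linearly_topologized_lsub W tV.
have tQ := linearly_topologized_lquot tV clW.
have cres := @restr_continuous _ _ _ _ phiW cphi.
have cind := @induced_continuous _ _ _ _ phiW cphi.
apply/eqP; rewrite eq_le; apply/andP; split.
  apply: ge_ereal_sup => _ [U lcU <-].
  have [U' [Q [_ lcU' lcQ _ ->]]] := entropy_at_additive R llcV cphi clW phiW lcU.
  apply: leeD; apply: ereal_sup_ubound; last exact: imageP.
  by apply: imageP; exact: lc_open_sub_in.
(* Finite values can be moved across inequalities between extended reals. *)
have fin_ent (X : discreteTvsType K) (psi : {linear X -> X}) U :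
    linearly_topologized X -> continuous psi -> lc_open X U ->
    entropy_at psi R U \is a fin_num.
  by move=> tX cpsi lcU; have [h _ ->] := entropy_at_growth R tX cpsi lcU.
have key U1 U2 : lc_open (lsub W) U1 -> lc_open (lquot W) U2 ->
    (entropy_at (restr phiW) R U1 + entropy_at (induced phiW) R U2 <= ent phi R)%E.
  move=> lcU1 lcU2.
  have [U [lcU U1U U2U]] := lc_open_cofinal llcV clW lcU1 lcU2.
  have [U' [Q [UU' lcU' lcQ QE UE]]] := entropy_at_additive R llcV cphi clW phiW lcU.
  apply: (@le_trans _ _ (entropy_at phi R U)); last first.
    by apply: ereal_sup_ubound; exists U.
  rewrite UE; apply: leeD; apply: entropy_at_le => //.
  - exact: lc_open_sub_in.
  - by move=> x /U1U; exact: UU'.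
  - by rewrite QE; apply: subset_trans U2U _; exact: image_subset.
have [U0 lcU0] := llcV.2.
have [Q0 lcQ0 _] := lc_open_lproj llcV clW lcU0.
(* The supremum over [U2] is taken first, with [U1] fixed. *)
have keyQ U1 : lc_open (lsub W) U1 ->
    (entropy_at (restr phiW) R U1 + ent (induced phiW) R <= ent phi R)%E.
  move=> lcU1; rewrite addeC -leeBrDr ?fin_ent//.
  apply: ge_ereal_sup => _ [U2 lcU2 <-].
  by rewrite leeBrDr ?fin_ent// addeC key.
have [fQ|] := boolP (ent (induced phiW) R \is a fin_num).
  rewrite -leeBrDr//; apply: ge_ereal_sup => _ [U1 lcU1 <-].
  by rewrite leeBrDr// keyQ.
(* Here the entropy on [V / W] is not finite; bounding a finite value from above, it is [+oo], and
   [keyQ] at a single subspace of [W] makes [ent phi] equal to [+oo] as well. *)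
have lcUW := lc_open_sub_in llcV clW lcU0.
have Qub : (entropy_at (induced phiW) R Q0 <= ent (induced phiW) R)%E.
  by apply: ereal_sup_ubound; exists Q0.
have := keyQ _ lcUW; have := fin_ent _ _ _ tW cres lcUW.
have := fin_ent _ _ _ tQ cind lcQ0; move: Qub.
case: (ent (induced phiW) R) => [//| |].
- case: (entropy_at (restr phiW) R _) => // r _ _ _.
  by rewrite addey// leye_eq => /eqP -> _; rewrite leey.
- by rewrite leeNy_eq => /eqP ->.
Qed.
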